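(* Let $k\in\mathbb N$, $f=\lambda z+\mathrm{h.o.t.}\in\mathcal L_k$ with $0<\lambda<1$, let $f_0$ be its normal form and $\varphi\in\mathcal L_k^0$ the unique parabolic transseries with $\varphi\circ f\circ\varphi^{-1}=f_0$. Let $h\in\mathfrak L^0$, say $h\in\mathcal L_m^0$, and let $r=\max\{k,m\}$. Then the generalized Koenigs sequence $\big(f_0^{\circ(-n)}\circ h\circ f^{\circ n}\big)_{n\in\mathbb N}$ converges to $\varphi$ in the weak topology of $\mathcal L_r$ if and only if $\mathrm{Lb}_z(h)=\mathrm{Lb}_z(\varphi)$.
   Context: $z$ infinitesimal; $\boldsymbol\ell_1:=-1/\ln z$, $\boldsymbol\ell_{j+1}:=\boldsymbol\ell_j\circ\boldsymbol\ell_1$. $\mathcal L_k$: formal sums $\sum a_{\alpha,n_1,\dots,n_k}z^\alpha\boldsymbol\ell_1^{n_1}\cdots\boldsymbol\ell_k^{n_k}$, real coefficients, well-ordered support in $\mathbb R_{\ge0}\times\mathbb Z^k$ (lexicographic); $\mathfrak L=\bigcup_k\mathcal L_k$; parabolic = leading term $z$; $\mathcal L_k^0$, $\mathfrak L^0$ the groups of parabolic elements under composition. Normal form: if $f=\lambda z+\sum_{\mathbf 0_k<\boldsymbol m\le\mathbf 1_k}a_{\boldsymbol m}z\boldsymbol\ell_1^{m_1}\cdots\boldsymbol\ell_k^{m_k}+\mathrm{h.o.t.}$ then $f_0:=\lambda z+\sum_{\mathbf 0_k<\boldsymbol m\le\mathbf 1_k}a_{\boldsymbol m}z\boldsymbol\ell_1^{m_1}\cdots\boldsymbol\ell_k^{m_k}$.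 $f_0^{\circ(-n)}$ is the $n$-th iterate of the compositional inverse of $f_0$. Blockwise writing: every $f\in\mathcal L_k$ is uniquely $f=\sum_{\alpha\in\mathrm{Supp}_z(f)}z^\alpha R_\alpha$ where $\mathrm{Supp}_z(f)\subseteq\mathbb R_{\ge0}$ is the set of exponents of $z$ occurring in $f$ and each $R_\alpha$ involves only $\boldsymbol\ell_1,\dots,\boldsymbol\ell_k$; the leading block $\mathrm{Lb}_z(f)$ is $z^{\alpha_0}R_{\alpha_0}$ with $\alpha_0=\min\mathrm{Supp}_z(f)$. Weak topology on $\mathcal L_r$: a sequence $(\varphi_n)$ converges to $\varphi$ iff for every $(\alpha,n_1,\dots,n_r)\in\mathbb R_{\ge0}\times\mathbb Z^r$ the coefficient of $z^\alpha\boldsymbol\ell_1^{n_1}\cdots\boldsymbol\ell_r^{n_r}$ in $\varphi_n$ tends (in $\mathbb R$) to that in $\varphi$. *)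

(* Defs.v *)
From Stdlib Require Import Reals.
From mathcomp Require Import all_boot all_order all_algebra.
From mathcomp Require Import boolp classical_sets fsbigop Rstruct.
Set Implicit Arguments. Unset Strict Implicit. Unset Printing Implicit Defensive.
Import GRing.Theory Num.Theory.
Local Open Scope classical_set_scope.
Local Open Scope ring_scope.

(* Monomials  z^a * l_1^{n 0} * l_2^{n 1} * ...   are encoded by (a, n) with  *)
(* a : R and n : nat -> int; the exponent of l_{j+1} is n j.  An element of   *)
(* L_k only uses monomials with n j = 0 for j >= k (i.e. only l_1..l_k).      *)
(* A (formal) series is its coefficient function.                             *)
Definition mono := (R * (nat -> int))%type.
Definition series := mono -> R.

Definition mzero : mono := (0, fun _ => 0).
Definition msub (m m1 : mono) : mono := (m.1 - m1.1, fun j => m.2 j - m1.2 j).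

Definition lexle (n p : nat -> int) : Prop :=
  n = p \/ exists j, n j < p j /\ forall i, (i < j)%N -> n i = p i.
Definition mle (m m' : mono) : Prop :=
  m.1 < m'.1 \/ (m.1 = m'.1 /\ lexle m.2 m'.2).

Definition support (f : series) : set mono := [set m | f m != 0].

Definition well_ordered (S : set mono) : Prop :=
  forall A : set mono, A `<=` S -> A !=set0 ->
    exists2 m, A m & forall m', A m' -> mle m m'.

Definition InL (k : nat) (f : series) : Prop :=
  (forall m, f m != 0 -> 0 <= m.1 /\ forall j, (k <= j)%N -> m.2 j = 0)
  /\ well_ordered (support f).

Definition lead_term_z (c : R) (f : series) : Prop :=
  f (1, fun _ => 0) = c /\ forall m, f m != 0 -> mle (1, fun _ => 0) m.

Definition parabolic (f : series) : Prop := lead_term_z 1 f.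

Definition mon (m : mono) : series := fun m' => if pselect (m' = m) then 1 else 0.
Definition sone : series := mon mzero.
Definition sadd (f g : series) : series := fun m => f m + g m.
Definition sscale (c : R) (f : series) : series := fun m => c * f m.
(* Cauchy product (finite sums for well-ordered supports) *)
Definition smul (f g : series) : series :=
  fun m => \sum_(m1 \in [set: mono]) (f m1 * g (msub m m1)).
Definition spow (f : series) (k : nat) : series := iter k (smul f) sone.
Definition ssum (I : choiceType) (F : I -> series) : series :=
  fun m => \sum_(i \in [set: I]) F i m.

Definition gbinom (a : R) (k : nat) : R :=
  (\prod_(i < k) (a - i%:R)) / (k`!)%:R.
(* (1 + x)^a  for infinitesimal x *)
Definition binser (a : R) (x : series) : series :=
  ssum (fun k : nat => sscale (gbinom a k) (spow x k)).
Definition logser (x : series) : series :=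
  ssum (fun k : nat => sscale ((-1) ^+ k / (k.+1)%:R) (spow x k.+1)).
Definition geom1 (y : series) : series := ssum (fun k : nat => spow y k.+1).

(* l_{j+1} *)
Definition ell (j : nat) : series :=
  mon (0, fun i => if i == j then 1 else 0).

(* --------- composition f o g, for g with leading term c*z (c > 0) --------- *)
(* write g = c z (1 + eps g) *)
Definition lcoef (g : series) : R := g (1, fun _ => 0).
Definition eps (g : series) : series :=
  fun m => if pselect (m = mzero) then 0
           else g (m.1 + 1, m.2) / lcoef g.
(* l_{j+1} o g = l_{j+1} (1 + delta g j) *)
Fixpoint delta (g : series) (j : nat) : series :=
  match j with
  | 0 => geom1 (smul (ell 0) (sadd (sscale (ln (lcoef g)) sone) (logser (eps g))))
  | j'.+1 => geom1 (smul (ell j'.+1) (logser (delta g j')))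
  end.

Definition nbound (n : nat -> int) : nat :=
  match pselect (exists N : nat, forall j, (N <= j)%N -> n j = 0) with
  | left P => proj1_sig (cid P)
  | right _ => 0%N
  end.

Definition mono_comp (m : mono) (g : series) : series :=
  smul (mon m)
    (smul (sscale (Rpower (lcoef g) m.1) (binser m.1 (eps g)))
          (\big[smul/sone]_(j < nbound m.2) binser (m.2 j)%:~R (delta g j))).

Definition tcomp (f g : series) : series :=
  fun m' => \sum_(m \in [set: mono]) (f m * mono_comp m g m').

Definition idz : series := mon (1, fun _ => 0).

Definition iterc (n : nat) (f : series) : series := iter n (tcomp f) idz.

Definition ones (k : nat) : nat -> int := fun j => if (j < k)%N then 1 else 0.
Definition normal_form (k : nat) (f : series) : series :=
  fun m => if pselect (m.1 = 1 /\ (forall j, (k <= j)%N -> m.2 j = 0)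
                       /\ lexle (fun _ => 0) m.2 /\ lexle m.2 (ones k))
           then f m else 0.

Definition leading_block (f : series) : series :=
  fun m => if pselect (forall m', f m' != 0 -> m.1 <= m'.1) then f m else 0.

Definition weak_cvg (r : nat) (u : nat -> series) (phi : series) : Prop :=
  forall (a : R) (n : nat -> int), 0 <= a -> (forall j, (r <= j)%N -> n j = 0) ->
    Un_cv (fun N => u N (a, n)) (phi (a, n)).

(* Main.v *)
From HB Require Import structures.
Require Import Defs.
From Stdlib Require Import Reals.
From mathcomp Require Import all_boot all_order all_algebra.
From mathcomp Require Import boolp classical_sets fsbigop Rstruct.
From mathcomp Require Import cardinality functions.
From mathcomp Require Import ring lra zify.
Set Implicit Arguments. Unset Strict Implicit. Unset Printing Implicit Defensive.
Import Order.TTheory GRing.Theory Num.Theory.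
Local Open Scope classical_set_scope.
Local Open Scope ring_scope.

(** Write K = max(k, m) and z for the monomial of exponent 1. The supports of all
the series g/(c z) - 1 involved, together with l_1, .., l_K, generate a monoid P
of monomials in which every element has finitely many factorisations (Neumann's
lemma). On series supported in P infinite sums are thus finite in each
coefficient, and right composition with g = c z (1 + x) becomes a linear operator
T_g on z * R[[P]], triangular in the monomial basis with diagonal entry c^a at a
monomial z^a l^n. Composition is associative, i.e. T_h T_g = T_(g o h), because
exponents and logarithms of 1 + x are multiplicative; this follows from the
coefficients of (1 + x)^a being polynomial in a.

Conjugation by phi gives T_f T_phi T_(f0^-1) = T_phi, so with
D_n := T_f^n (T_h - T_phi) T_(f0^-1)^n the n-th Koenigs element minus phi is D_n z.
Let d be the quotient by z of the leading monomial of h - phi. All D_n raise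
monomials by at least d, and D_(n+1) = T_f D_n T_(f0^-1) is, entrywise,
multiplication by lam^a on the entry that raises monomials by z^a l^n, plus a
finite combination of entries raising by proper divisors of z^a l^n. Hence the
entry (z d, z) of D_n is lam^(n a) times its initial nonzero value, where a is the
z-exponent of d: it is constant when a = 0, that is when the leading blocks of h
and phi differ. When a > 0 every entry tends to 0, by induction on the number of
divisors. *)

(** * Finite sums over any list that covers the support *)

Lemma big_uniq_supp (V : nmodType) (I : eqType) (s t : seq I) (F : I -> V) :
  uniq s -> uniq t -> (forall i, F i != 0 -> (i \in s) = (i \in t)) ->
  \sum_(i <- s) F i = \sum_(i <- t) F i.
Proof.
move=> us ut st; rewrite [LHS](bigID (fun i => F i != 0)) [RHS](bigID (fun i => F i != 0)) /=.
rewrite [X in _ + X = _]big1 ?[X in _ = _ + X]big1 ?addr0; last 2 first.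
- by move=> i /negPn /eqP.
- by move=> i /negPn /eqP.
rewrite -[LHS]big_filter -[RHS]big_filter; apply: perm_big.
apply: uniq_perm; rewrite ?filter_uniq // => i; rewrite !mem_filter.
by case: (boolP (F i != 0)) => //= /st.
Qed.

Lemma fsum_uniq_supp (V : nmodType) (I : choiceType) (s : seq I) (F : I -> V) :
  uniq s -> (forall i, F i != 0 -> i \in s) ->
  \sum_(i \in [set: I]) F i = \sum_(i <- s) F i.
Proof.
move=> us Fs; rewrite (fsbigE s) //.
  by apply: eq_bigl => i; rewrite in_setT.
by move=> i _ /negP ins; apply: contrapT => /eqP /Fs.
Qed.

(** * Series supported in a locally finite monoid *)

(** Finitely many factorisations make Cauchy products finite sums; the absence of units other than 0
    makes divisibility a partial order. *)
Record lfmonoid (G : zmodType) := LFMonoid {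
  lfm_set :> G -> Prop;
  lfm0 : lfm_set 0;
  lfmD : forall a b, lfm_set a -> lfm_set b -> lfm_set (a + b);
  lfm_pointed : forall a, lfm_set a -> lfm_set (- a) -> a = 0;
  lfm_fin : forall q, finite_set [set p | lfm_set p /\ lfm_set (q - p)] }.

Section Dvd.
Variables (G : zmodType) (P : lfmonoid G).

Lemma dv_exists (q : G) :
  exists s : seq G, uniq s /\ forall p, (p \in s) <-> (P p /\ P (q - p)).
Proof.
have /finite_seqP [s sE] := lfm_fin P q.
exists (undup s); split; first exact: undup_uniq.
move=> p; rewrite mem_undup.
have -> : (P p /\ P (q - p)) = [set` s] p by rewrite -sE.
by [].
Qed.

(** The divisors of [q], in additive notation. The list is empty when [q] is outside [P], so sums
    over it vanish there by themselves. *)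
Definition dv (q : G) : seq G := projT1 (cid (dv_exists q)).

Lemma dv_uniq q : uniq (dv q).
Proof. by rewrite /dv; case: cid => s /= []. Qed.

Lemma dvP p q : reflect (P p /\ P (q - p)) (p \in dv q).
Proof. by rewrite /dv; case: cid => s /= [_ sE]; apply: (iffP idP) => /sE. Qed.

Lemma dv_trans r p q : r \in dv p -> p \in dv q -> r \in dv q.
Proof.
move=> /dvP[Pr Ppr] /dvP[Pp Pqp]; apply/dvP; split => //.
have -> : q - r = (q - p) + (p - r) by rewrite addrA subrK.
exact: lfmD.
Qed.

Lemma dv_refl q : P q -> q \in dv q.
Proof. by move=> Pq; apply/dvP; rewrite subrr; split => //; apply: lfm0. Qed.

Lemma dv_gt0 p q : p \in dv q -> P q.
Proof. by move=> /dvP[Pp Pqp]; rewrite -(subrK p q); apply: lfmD. Qed.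

Lemma dv_sub p q : p \in dv q -> q - p \in dv q.
Proof. by move=> /dvP[Pp Pqp]; apply/dvP; rewrite subKr. Qed.

Lemma leq_size_dv p q : p \in dv q -> (size (dv p) <= size (dv q))%N.
Proof.
move=> pq; apply: uniq_leq_size; first exact: dv_uniq.
by move=> r rp; apply: dv_trans pq.
Qed.

(** A proper divisor [p] of [q] is not divisible by [q], by pointedness. The number of divisors thus
    serves as a measure for inductions along strict divisibility. *)
Lemma ltn_size_dv p q : p \in dv q -> p != q -> (size (dv p) < size (dv q))%N.
Proof.
move=> pq pnq.
have qq : q \in dv q by apply: dv_refl; apply: dv_gt0 pq.
have : (size (q :: dv p) <= size (dv q))%N.
  apply: uniq_leq_size.
    rewrite /= dv_uniq andbT; apply/negP => /dvP[Pq Ppq].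
    move: (pq) => /dvP[Pp Pqp]; move/eqP: pnq; apply.
    apply/eqP; rewrite -subr_eq0; apply/eqP.
    by apply: (lfm_pointed Ppq); rewrite opprB.
  by move=> r; rewrite inE => /predU1P[-> //|rp]; apply: dv_trans pq.
by [].
Qed.

End Dvd.

Section HSeries.
Variables (G : zmodType) (P : lfmonoid G) (F : numFieldType).

(** The support condition is a boolean, so that the series form a subtype and equality is equality
    of coefficients. *)
Record hser := Hser {
  hcoef :> G -> F;
  hcoefP : `[< forall m, ~ P m -> hcoef m = 0 >] }.

HB.instance Definition _ := [isSub for hcoef].
HB.instance Definition _ := [Choice of hser by <:].

Implicit Types x y w : hser.

Lemma hser_out x m : ~ P m -> x m = 0.
Proof. by have /asboolP := hcoefP x; apply. Qed.

Lemma hser_in x m : x m != 0 -> P m.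
Proof. by move=> xm; apply: contrapT => /(hser_out x) x0; rewrite x0 eqxx in xm. Qed.

Lemma hserP x y : (forall m, x m = y m) -> x = y.
Proof. by move=> xy; apply: val_inj; apply/funext. Qed.

(** Cutting [u] off outside [P] lets [mkh] be total; the specification then speaks only of those [u]
    that already vanish there. *)
Lemma mkh_ex (u : G -> F) :
  {x : hser | (forall q, ~ P q -> u q = 0) -> forall m, x m = u m}.
Proof.
have uP : `[< forall m, ~ P m -> (if `[< P m >] then u m else 0) = 0 >].
  by apply/asboolP => m Pm; rewrite asboolF.
by exists (Hser uP) => u0 m /=; case: asboolP => // /u0.
Qed.

Definition mkh (u : G -> F) : hser := sval (mkh_ex u).

Lemma mkhE u m : (forall q, ~ P q -> u q = 0) -> mkh u m = u m.
Proof. by rewrite /mkh; case: mkh_ex => x /= h /h. Qed.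

Definition hzero : hser := mkh (fun _ => 0).
Definition hadd x y : hser := mkh (fun m => x m + y m).
Definition hopp x : hser := mkh (fun m => - x m).
Definition hscale (a : F) x : hser := mkh (fun m => a * x m).
Definition hmon (p : G) : hser := mkh (fun m => (m == p)%:R).
Definition hmul x y : hser := mkh (fun q => \sum_(p <- dv P q) x p * y (q - p)).

Lemma hzeroE m : hzero m = 0. Proof. by rewrite mkhE. Qed.
Lemma haddE x y m : hadd x y m = x m + y m.
Proof. by rewrite mkhE // => q Pq; rewrite !hser_out ?addr0. Qed.
Lemma hoppE x m : hopp x m = - x m.
Proof. by rewrite mkhE // => q Pq; rewrite !hser_out ?oppr0. Qed.
Lemma hscaleE a x m : hscale a x m = a * x m.
Proof. by rewrite mkhE // => q Pq; rewrite !hser_out ?mulr0. Qed.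
Lemma hmonE p m : P p -> hmon p m = (m == p)%:R.
Proof. by move=> Pp; rewrite mkhE // => q Pq; case: eqP => // qp; case: Pq; rewrite qp. Qed.
Lemma hmulE x y q : hmul x y q = \sum_(p <- dv P q) x p * y (q - p).
Proof.
rewrite mkhE // => m Pm; rewrite big_seq big1 // => p /dv_gt0 //.
Qed.

(** Together with [hmul_shift] this puts both bracketings of a triple product over the single list
    [dv P q], so that associativity becomes an exchange of sums. *)
Lemma hmul_wide x y p q : p \in dv P q ->
  hmul x y p = \sum_(s <- dv P q) x s * y (p - s).
Proof.
move=> pq; rewrite hmulE; apply: big_uniq_supp; rewrite ?dv_uniq // => s.
rewrite mulf_eq0 negb_or => /andP[/hser_in Ps /hser_in Pps].
have sp : s \in dv P p by apply/dvP.
by rewrite sp (dv_trans sp pq).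
Qed.

Lemma hmul_shift x y s q : s \in dv P q ->
  hmul x y (q - s) = \sum_(p <- dv P q) x (p - s) * y (q - p).
Proof.
move=> sq; rewrite hmulE.
have -> : \sum_(p <- dv P (q - s)) x p * y (q - s - p) =
  \sum_(p <- [seq t + s | t <- dv P (q - s)]) x (p - s) * y (q - p).
  by rewrite big_map; apply: eq_bigr => t _; rewrite addrK addrAC opprD addrA.
apply: big_uniq_supp; rewrite ?dv_uniq // ?map_inj_uniq ?dv_uniq //.
  by move=> a b /addIr.
move=> p; rewrite mulf_eq0 negb_or => /andP[/hser_in Pps /hser_in Pqp].
move/dvP: sq => [Ps Pqs].
have -> : p \in dv P q by apply/dvP; split=> //; rewrite -(subrK s p); apply: lfmD.
apply/mapP; exists (p - s); last by rewrite subrK.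
by apply/dvP; split=> //; rewrite opprB addrA subrK.
Qed.

Fact haddA : associative hadd.
Proof. by move=> x y w; apply: hserP => m; rewrite !haddE addrA. Qed.
Fact haddC : commutative hadd.
Proof. by move=> x y; apply: hserP => m; rewrite !haddE addrC. Qed.
Fact hadd0 : left_id hzero hadd.
Proof. by move=> x; apply: hserP => m; rewrite haddE hzeroE add0r. Qed.
Fact haddN : left_inverse hzero hopp hadd.
Proof. by move=> x; apply: hserP => m; rewrite haddE hoppE hzeroE addNr. Qed.

HB.instance Definition _ := GRing.isZmodule.Build hser haddA haddC hadd0 haddN.

Fact hmulA : associative hmul.
Proof.
move=> x y w; apply: hserP => q; rewrite !hmulE.
under eq_big_seq => p pq do rewrite hmul_shift // mulr_sumr.
under [RHS]eq_big_seq => p pq do rewrite (hmul_wide _ _ pq) mulr_suml.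
rewrite exchange_big /=; apply: eq_bigr => p _; apply: eq_bigr => s _.
by rewrite mulrA.
Qed.

Fact hmulC : commutative hmul.
Proof.
move=> x y; apply: hserP => q; rewrite !hmulE.
have qK : involutive (fun p : G => q - p) by move=> p; rewrite subKr.
have -> : \sum_(p <- dv P q) x p * y (q - p) =
  \sum_(p <- [seq q - p | p <- dv P q]) x (q - p) * y p.
  by rewrite big_map; apply: eq_bigr => p _; rewrite subKr.
under [RHS]eq_bigr do rewrite mulrC.
apply: big_uniq_supp; rewrite ?dv_uniq ?map_inj_uniq ?dv_uniq //.
  exact: (inv_inj qK).
move=> p _; apply/mapP/idP => [[r rq ->]|pq]; first exact: dv_sub.
by exists (q - p); rewrite ?subKr // dv_sub.
Qed.

Lemma hmul_mon p y q : P p -> hmul (hmon p) y q = y (q - p).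
Proof.
move=> Pp; rewrite hmulE.
have [Pqp|nPqp] := pselect (P (q - p)).
  rewrite (bigD1_seq p) ?dv_uniq //=; last exact/dvP.
  rewrite -[RHS]addr0; congr (_ + _); first by rewrite hmonE // eqxx mul1r.
  rewrite big1_seq // => r /andP[/negPf rp _].
  by rewrite hmonE // rp mul0r.
rewrite [RHS]hser_out // big1_seq // => r /andP[_ /dvP[Pr Pqr]].
by rewrite hmonE //; case: eqP Pqr => [-> //|]; rewrite mul0r.
Qed.

Fact hmul1 : left_id (hmon 0) hmul.
Proof. by move=> x; apply: hserP => m; rewrite hmul_mon ?subr0 //; apply: lfm0. Qed.
Fact hmulDl : left_distributive hmul hadd.
Proof.
move=> x y w; apply: hserP => q; rewrite haddE !hmulE -big_split /=.
by apply: eq_bigr => p _; rewrite haddE mulrDl.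
Qed.
Fact hone_neq0 : hmon 0 != hzero.
Proof.
apply/eqP => /(congr1 (fun x : hser => x 0)); rewrite hzeroE hmonE ?eqxx; last exact: lfm0.
by move/eqP; rewrite oner_eq0.
Qed.

HB.instance Definition _ :=
  GRing.Zmodule_isComNzRing.Build hser hmulA hmulC hmul1 hmulDl hone_neq0.

Fact hscaleA a b x : hscale a (hscale b x) = hscale (a * b) x.
Proof. by apply: hserP => m; rewrite !hscaleE mulrA. Qed.
Fact hscale1 : left_id 1 hscale.
Proof. by move=> x; apply: hserP => m; rewrite !hscaleE mul1r. Qed.
Fact hscaleDr : right_distributive hscale +%R.
Proof. by move=> a x y; apply: hserP => m; rewrite !(hscaleE, haddE) mulrDr. Qed.
Fact hscaleDl x : {morph hscale^~ x : a b / a + b}.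
Proof. by move=> a b; apply: hserP => m; rewrite !(hscaleE, haddE) mulrDl. Qed.

HB.instance Definition _ :=
  GRing.Zmodule_isLmodule.Build F hser hscaleA hscale1 hscaleDr hscaleDl.

Fact hscaleAl (a : F) x y : a *: (x * y) = (a *: x) * y.
Proof.
apply: hserP => q; rewrite hscaleE !hmulE mulr_sumr.
by apply: eq_bigr => p _; rewrite hscaleE mulrA.
Qed.

HB.instance Definition _ := GRing.Lmodule_isLalgebra.Build F hser hscaleAl.
HB.instance Definition _ := GRing.Lalgebra_isComAlgebra.Build F hser.

Lemma hcoef0 m : (0 : hser) m = 0. Proof. exact: hzeroE. Qed.
Lemma hcoefD x y m : (x + y) m = x m + y m. Proof. exact: haddE. Qed.
Lemma hcoefN x m : (- x) m = - x m. Proof. exact: hoppE. Qed.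
Lemma hcoefB x y m : (x - y) m = x m - y m. Proof. by rewrite hcoefD hcoefN. Qed.
Lemma hcoefZ a x m : (a *: x) m = a * x m. Proof. exact: hscaleE. Qed.
Lemma hcoefM x y q : (x * y) q = \sum_(p <- dv P q) x p * y (q - p).
Proof. exact: hmulE. Qed.
Lemma hcoef1 m : (1 : hser) m = (m == 0)%:R.
Proof. by apply: hmonE; apply: lfm0. Qed.
Lemma hcoef_monM p y q : P p -> (hmon p * y) q = y (q - p).
Proof. exact: hmul_mon. Qed.
Lemma hcoef_sum (I : Type) (s : seq I) (X : I -> hser) m :
  (\sum_(i <- s) X i) m = \sum_(i <- s) X i m.
Proof.
elim: s => [|i s IH]; first by rewrite !big_nil hcoef0.
by rewrite !big_cons hcoefD IH.
Qed.

Lemma hmon0 : hmon 0 = 1. Proof. by []. Qed.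
Lemma hmonD p q : P p -> P q -> hmon (p + q) = hmon p * hmon q.
Proof.
move=> Pp Pq; apply: hserP => m; rewrite hcoef_monM // !hmonE //; last exact: lfmD.
by rewrite subr_eq addrC.
Qed.

Lemma hcoefM0 x y : (x * y) 0 = x 0 * y 0.
Proof.
rewrite hcoefM (bigD1_seq 0) ?dv_uniq //=; last by apply: dv_refl; apply: lfm0.
rewrite subr0 -[RHS]addr0; congr (_ + _); rewrite big1_seq // => p /andP[/negP p0 /dvP[Pp]].
by rewrite sub0r => /(lfm_pointed Pp) p0'; case: p0; rewrite p0'.
Qed.

End HSeries.

(** * Substitution into power series, and operators determined by monomials *)

Section PowerSeries.
Variables (G : zmodType) (P : lfmonoid G) (F : numFieldType).
Local Notation B := (hser P F).
Implicit Types (x y u v : B) (c : nat -> F).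

(** Each factor [x] uses up a nonzero monomial and leaves a proper divisor of [q]; such a chain
    cannot be longer than the list of divisors. *)
Lemma coefX_eq0 x k q : x 0 = 0 -> (size (dv P q) <= k)%N -> (x ^+ k) q = 0.
Proof.
move=> x0; elim: k q => [|k IH] q.
  rewrite leqn0 size_eq0 => /eqP dq0; rewrite expr0 hser_out // => Pq.
  by have := dv_refl Pq; rewrite dq0.
move=> le; rewrite exprS hcoefM big1_seq // => p /andP[_ pq].
have [->|p0] := eqVneq p 0; first by rewrite x0 mul0r.
rewrite IH ?mulr0 // -ltnS; apply: leq_trans le; apply: ltn_size_dv (dv_sub pq) _.
by rewrite -subr_eq0 addrC addrA addNr add0r oppr_eq0.
Qed.

(** The series [sum_k c k x^k]. Stopping at the number of divisors of [q] loses nothing when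
    [x 0 = 0], by [coefX_eq0]. *)
Definition psapp c x : B :=
  mkh P (fun q => \sum_(k < size (dv P q)) c k * (x ^+ k) q).

Lemma psappE_size c x q : psapp c x q = \sum_(k < size (dv P q)) c k * (x ^+ k) q.
Proof. by rewrite mkhE // => m Pm; rewrite big1 // => i _; rewrite hser_out ?mulr0. Qed.

Lemma psappE c x q N : x 0 = 0 -> (size (dv P q) <= N)%N ->
  psapp c x q = \sum_(k < N) c k * (x ^+ k) q.
Proof.
move=> x0 qN; rewrite psappE_size (big_ord_widen _ (fun k => c k * (x ^+ k) q) qN).
rewrite big_mkcond; apply: eq_bigr => i _; case: ltnP => // qi.
by rewrite coefX_eq0 ?mulr0.
Qed.

Lemma psapp_trunc c x q p : x 0 = 0 -> p \in dv P q ->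
  psapp c x p = (\sum_(k < size (dv P q)) c k *: x ^+ k) p.
Proof.
move=> x0 pq; rewrite (psappE _ x0 (leq_size_dv pq)) hcoef_sum.
by apply: eq_bigr => i _; rewrite hcoefZ.
Qed.

Lemma psapp0 c x : c 0 = 0 -> x 0 = 0 -> psapp c x 0 = 0.
Proof.
move=> c0 x0; rewrite psappE_size big1 // => -[[|k] ?] _ /=; first by rewrite c0 mul0r.
by rewrite exprS hcoefM0 x0 mul0r mulr0.
Qed.

(** Linear operators whose coefficient at [q] depends only on the coefficients of the argument at
    divisors of [q]. This algebraic substitute for continuity makes an operator determined by its
    values on monomials. *)
Definition cont (D : B -> B) :=
  (forall a u v, D (a *: u + v) = a *: D u + D v) /\
  (forall q u, (forall p, p \in dv P q -> u p = 0) -> D u q = 0).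

Lemma cont_local D q u v : cont D -> (forall p, p \in dv P q -> u p = v p) ->
  D u q = D v q.
Proof.
move=> [lD cD] uv; have : D (-1 *: v + u) q = 0.
  by apply: cD => p /uv uvp; rewrite hcoefD hcoefZ uvp mulN1r addNr.
by rewrite lD hcoefD hcoefZ mulN1r => /eqP; rewrite addrC subr_eq0 => /eqP.
Qed.

Lemma cont0 D : cont D -> D 0 = 0.
Proof.
by move=> [lD _]; have := lD (-1) 0 0; rewrite scaler0 addr0 scaleN1r addNr.
Qed.

Lemma cont_sum D (I : Type) (s : seq I) (a : I -> F) (u : I -> B) : cont D ->
  D (\sum_(i <- s) a i *: u i) = \sum_(i <- s) a i *: D (u i).
Proof.
move=> cD; elim: s => [|i s IH]; first by rewrite !big_nil cont0.
by rewrite !big_cons cD.1 IH.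
Qed.

Lemma cont_add D u v : cont D -> D (u + v) = D u + D v.
Proof. by move=> [lD _]; have := lD 1 u v; rewrite !scale1r. Qed.

Lemma cont_scale D a u : cont D -> D (a *: u) = a *: D u.
Proof. by move=> cD; have := cD.1 a u 0; rewrite addr0 (cont0 cD) addr0. Qed.

Lemma cont_coef D u q : cont D ->
  D u q = \sum_(p <- dv P q) u p * D (hmon P F p) q.
Proof.
move=> cD; transitivity (D (\sum_(p <- dv P q) u p *: hmon P F p) q).
  apply: cont_local => // r rq; rewrite hcoef_sum (bigD1_seq r) ?dv_uniq //=.
  have Pr : P r by case/dvP: rq.
  rewrite hcoefZ hmonE // eqxx mulr1 big1_seq ?addr0 // => p /andP[/negPf pr /dvP[Pp _]].
  by rewrite hcoefZ hmonE // eq_sym pr mulr0.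
by rewrite cont_sum // hcoef_sum; apply: eq_bigr => p _; rewrite hcoefZ.
Qed.

Lemma cont_ext D E : cont D -> cont E ->
  (forall p, P p -> D (hmon P F p) = E (hmon P F p)) -> D =1 E.
Proof.
move=> cD cE DE u; apply: hserP => q; rewrite !(cont_coef u q) //.
by apply: eq_big_seq => p /dvP[/DE -> _].
Qed.

Lemma cont_id : cont id.
Proof.
split=> // q u u0; have [Pq|nPq] := pselect (P q); last exact: hser_out.
by apply: u0; apply: dv_refl.
Qed.

Lemma cont_comp D E : cont D -> cont E -> cont (fun u => D (E u)).
Proof.
move=> [lD cD] [lE cE]; split=> [a u v|q u u0]; first by rewrite lE lD.
by apply: cD => p pq; apply: cE => r rp; apply: u0; apply: dv_trans pq.
Qed.

Lemma cont_mulr y : cont (fun u => u * y).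
Proof.
split=> [a u v|q u u0]; first by rewrite mulrDl scalerAl.
by rewrite hcoefM big1_seq // => p /andP[_ /u0 ->]; rewrite mul0r.
Qed.

Lemma cont_mull y : cont (fun u => y * u).
Proof.
have -> : (fun u => y * u) = (fun u => u * y) by apply/funext => u; rewrite mulrC.
exact: cont_mulr.
Qed.

Lemma cont_sub D E : cont D -> cont E -> cont (fun u => D u - E u).
Proof.
move=> [lD cD] [lE cE]; split=> [a u v|q u u0].
  by rewrite lD lE scalerBr opprD addrACA.
by rewrite hcoefB cD // cE // subr0.
Qed.

(** By locality the series may be replaced, at each coefficient, by a polynomial in [x], with which
    a multiplicative linear operator commutes. *)
Lemma cont_psapp D c x : cont D -> {morph D : u v / u * v} -> D 1 = 1 ->
  x 0 = 0 -> D (psapp c x) = psapp c (D x).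
Proof.
move=> cD mD D1 x0.
have DX k : D (x ^+ k) = D x ^+ k by elim: k => [//|k IH]; rewrite !exprS mD IH.
apply: hserP => q; rewrite (cont_local cD (fun p => @psapp_trunc c x q p x0)).
rewrite cont_sum // hcoef_sum psappE_size.
by apply: eq_bigr => k _; rewrite hcoefZ DX.
Qed.

(** The operator that sends each monomial [p] to [p * U p]. Right composition has this form, [U p]
    being the factor that [p] acquires. *)
Definition hsubst (U : G -> B) u : B :=
  mkh P (fun q => \sum_(p <- dv P q) u p * U p (q - p)).

Lemma hsubstE U u q : hsubst U u q = \sum_(p <- dv P q) u p * U p (q - p).
Proof. by rewrite mkhE // => m Pm; rewrite big1_seq // => p /andP[_ /dv_gt0]. Qed.

Lemma cont_hsubst U : cont (hsubst U).
Proof.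
split=> [a u v|q u u0].
  apply: hserP => q; rewrite hcoefD hcoefZ !hsubstE mulr_sumr -big_split /=.
  by apply: eq_bigr => p _; rewrite hcoefD hcoefZ mulrDl mulrA.
by rewrite hsubstE big1_seq // => p /andP[_ /u0 ->]; rewrite mul0r.
Qed.

Lemma hsubst_mon U p : P p -> hsubst U (hmon P F p) = hmon P F p * U p.
Proof.
move=> Pp; apply: hserP => q; rewrite hcoef_monM // hsubstE.
have [pq|pq] := boolP (p \in dv P q).
  rewrite (bigD1_seq p) ?dv_uniq //= hmonE // eqxx mul1r big1_seq ?addr0 //.
  by move=> r /andP[/negPf rp _]; rewrite hmonE // rp mul0r.
rewrite hser_out; last by move=> Pqp; case/negP: pq; apply/dvP.
rewrite big1_seq // => r /andP[_ rq]; rewrite hmonE //.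
by case: eqP rq pq => [-> ->|]; rewrite ?mul0r.
Qed.

Lemma hsubst1 U : U 0 = 1 -> hsubst U 1 = 1.
Proof. by move=> U0; rewrite -hmon0 hsubst_mon ?U0 ?mulr1 //; apply: lfm0. Qed.

(** Both sides are [cont] in each argument separately, so the comparison reduces to two
    monomials. *)
Lemma hsubstM U : (forall p q, P p -> P q -> U (p + q) = U p * U q) ->
  {morph hsubst U : u v / u * v}.
Proof.
move=> UD u v; have cU := cont_hsubst U.
apply: (cont_ext (cont_comp cU (cont_mulr v))
                 (cont_comp (cont_mulr (hsubst U v)) cU)) => p Pp /=.
apply: (cont_ext (cont_comp cU (cont_mull _))
                 (cont_comp (cont_mull _) cU)) => q Pq /=.
rewrite -hmonD // !hsubst_mon //; last exact: lfmD.
by rewrite hmonD // UD //; ring.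
Qed.

Lemma hsubst0 U u : hsubst U u 0 = u 0 * U 0 0.
Proof.
rewrite hsubstE (bigD1_seq 0) ?dv_uniq //=; last by apply: dv_refl; apply: lfm0.
rewrite subr0 big1_seq ?addr0 // => p /andP[/negP p0 /dvP[Pp]].
by rewrite sub0r => /(lfm_pointed Pp) p0'; case: p0; rewrite p0'.
Qed.

(** For [I] stable under adding elements of [P] this is an ideal, and [hideal I (x - y)] is
    congruence modulo it. *)
Definition hideal (I : set G) x := forall m, x m != 0 -> I m.

Lemma hideal0 I : hideal I 0.
Proof. by move=> m; rewrite hcoef0 eqxx. Qed.

Lemma hidealD I x y : hideal I x -> hideal I y -> hideal I (x + y).
Proof.
move=> Ix Iy m; rewrite hcoefD; have [->|/Ix //] := eqVneq (x m) 0.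
by rewrite add0r => /Iy.
Qed.

Lemma hidealM I x y : (forall a b, I a -> P b -> I (a + b)) ->
  hideal I x -> hideal I (x * y).
Proof.
move=> IP Ix m; rewrite hcoefM => xy0; apply: contrapT => nIm; case/eqP: xy0.
rewrite big1_seq // => p /andP[_ /dvP[_ Pmp]].
apply/eqP; apply/negPn/negP; rewrite mulf_eq0 negb_or => /andP[/Ix Ip _].
by apply: nIm; rewrite -(subrK p m) addrC; apply: IP.
Qed.

Lemma hidealZ I a x : hideal I x -> hideal I (a *: x).
Proof. by move=> Ix m; rewrite hcoefZ mulf_eq0 negb_or => /andP[_ /Ix]. Qed.

Lemma hideal_subM I x y u v : (forall a b, I a -> P b -> I (a + b)) ->
  hideal I (x - y) -> hideal I (u - v) -> hideal I (x * u - y * v).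
Proof.
move=> IP Ixy Iuv; have -> : x * u - y * v = (x - y) * u + (u - v) * y by ring.
by apply: hidealD; apply: hidealM.
Qed.

Lemma hideal_psapp I c x y : (forall a b, I a -> P b -> I (a + b)) ->
  hideal I (x - y) -> hideal I (psapp c x - psapp c y).
Proof.
move=> IP Ixy; have Ik k : hideal I (x ^+ k - y ^+ k).
  elim: k => [|k IH]; first by rewrite !expr0 subrr; apply: hideal0.
  by rewrite !exprS; apply: hideal_subM.
move=> m; rewrite hcoefB !psappE_size => xy0; apply: contrapT => nIm.
case/eqP: xy0; rewrite -sumrB big1 // => i _; rewrite -mulrBr -hcoefB.
apply/eqP; apply/negPn/negP; rewrite mulf_eq0 negb_or => /andP[_].
by move=> /Ik.
Qed.

End PowerSeries.

(** * Binomial, logarithmic and geometric series *)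

Section Binomial.
Variables (G : zmodType) (P : lfmonoid G) (F : numFieldType).
Local Notation B := (hser P F).
Implicit Types (x y u v : B).

(** The binomial coefficient [X] over [k] as a polynomial in [X]. *)
Definition gpoly k : {poly F} := (k`!%:R)^-1 *: \prod_(i < k) ('X - i%:R%:P).

Lemma gpoly_horner k a : (gpoly k).[a] = (\prod_(i < k) (a - i%:R)) / k`!%:R.
Proof.
rewrite /gpoly hornerZ horner_prod mulrC; congr (_ * _).
by apply: eq_bigr => i _; rewrite !hornerE.
Qed.

Lemma gpoly_nat n k : (gpoly k).[n%:R] = 'C(n, k)%:R.
Proof.
rewrite gpoly_horner; apply: (mulIf (x := k`!%:R)); first by rewrite pnatr_eq0 -lt0n fact_gt0.
rewrite divfK ?pnatr_eq0 -?lt0n ?fact_gt0 // -natrM bin_ffact.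
elim: k => [|k IH]; first by rewrite big_ord0 ffactn0.
rewrite big_ord_recr /= IH ffactnSr natrM.
have [kn|nk] := leqP k n; first by rewrite natrB.
by rewrite ffact_small // !mul0r.
Qed.

(** This is the coefficient of [x^(k+1)] in [log(1 + x)], as expected since the logarithm is the
    derivative of [(1 + x)^a] at [a = 0]. *)
Lemma gpoly_coef1 k : (gpoly k.+1)`_1 = (-1) ^+ k / k.+1%:R.
Proof.
rewrite /gpoly coefZ big_ord_recl /= subr0 coefXM /= -horner_coef0 horner_prod.
under eq_bigr => i _ do rewrite !hornerE /bump /= add1n -mulN1r.
rewrite big_split /= prodr_const card_ord.
have -> : \prod_(i < k) (i.+1%:R : F) = k`!%:R.
  by rewrite fact_prod big_add1 /= big_mkord natr_prod.
rewrite factS natrM invfM mulrC -!mulrA; congr (_ * _).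
by rewrite mulrCA divff ?mulr1 // pnatr_eq0 -lt0n fact_gt0.
Qed.

Lemma poly_nat_ext (p r : {poly F}) : (forall n : nat, p.[n%:R] = r.[n%:R]) -> p = r.
Proof.
move=> pr; apply/eqP; rewrite -subr_eq0; apply/negPn/negP => d0.
pose rs : seq F := [seq n%:R | n <- iota 0 (size (p - r))].
have ar : all (root (p - r)) rs.
  by apply/allP => _ /mapP[n _ ->]; rewrite rootE hornerD hornerN pr subrr.
have ur : uniq rs.
  by rewrite map_inj_uniq ?iota_uniq // => a b /eqP; rewrite eqr_nat => /eqP.
by have := max_poly_roots d0 ar ur; rewrite size_map size_iota ltnn.
Qed.

(** The three series are [(1 + x)^a], [log(1 + x)] and [1/(1 - x) - 1]. *)
Definition bin a x := psapp (fun k => (gpoly k).[a]) x.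
Definition hlog x := psapp (fun k => (gpoly k)`_1) x.
Definition geom x := psapp (fun k => (0 < k)%:R) x.

(* The coefficients of (1 + x)^a are polynomial in a; those of log (1 + x) are
   the linear coefficients of these polynomials. *)
Definition binp x q : {poly F} := \sum_(k < size (dv P q)) (x ^+ k) q *: gpoly k.

Lemma binpE a x q : (binp x q).[a] = bin a x q.
Proof.
rewrite psappE_size horner_sum; apply: eq_bigr => i _.
by rewrite hornerZ mulrC.
Qed.

Lemma hlogE x q : hlog x q = (binp x q)`_1.
Proof.
rewrite psappE_size /binp coef_sum; apply: eq_bigr => i _.
by rewrite [RHS]coefZ mulrC.
Qed.

Lemma bin_nat (n : nat) x : x 0 = 0 -> bin n%:R x = (1 + x) ^+ n.
Proof.
move=> x0; apply: hserP => q.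
rewrite (@psappE _ _ _ _ _ _ (maxn (size (dv P q)) n.+1) x0) ?leq_maxl //.
rewrite exprDn (big_ord_widen _ (fun k => 1 ^+ (n - k) * x ^+ k *+ 'C(n, k))
  (leq_maxr (size (dv P q)) n.+1)) [in RHS]big_mkcond hcoef_sum.
apply: eq_bigr => i _; rewrite gpoly_nat; case: ltnP => ni.
  by rewrite expr1n mul1r -scaler_nat hcoefZ.
by rewrite bin_small // mul0r hcoef0.
Qed.

Lemma bin0 x : x 0 = 0 -> bin 0 x = 1.
Proof. by move=> /(bin_nat 0) ->. Qed.

Lemma bin1 x : x 0 = 0 -> bin 1 x = 1 + x.
Proof. by move=> /(bin_nat 1) ->. Qed.

(** Multiplication of the units [1 + x], carried over to their parts without constant term. *)
Definition bmul x y : B := x + y + x * y.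

Lemma bmulE x y : 1 + bmul x y = (1 + x) * (1 + y).
Proof. by rewrite /bmul; ring. Qed.

Lemma bmul0 x y : x 0 = 0 -> y 0 = 0 -> bmul x y 0 = 0.
Proof. by move=> x0 y0; rewrite !hcoefD hcoefM0 x0 y0 mul0r !addr0. Qed.

Lemma bin_coef0 a x : x 0 = 0 -> bin a x 0 = 1.
Proof.
move=> x0.
have -> : bin a x 0 = (bin 0 x) 0; last by rewrite bin0 // hcoef1 eqxx.
rewrite !psappE_size; apply: eq_bigr => -[[|k] ?] _ /=.
  by rewrite !gpoly_horner !big_ord0.
by rewrite exprS hcoefM0 x0 mul0r !mulr0.
Qed.

(** At a natural exponent this is the power of a product, and polynomials that agree at all naturals
    are equal. *)
Lemma binp_bmul x y q : x 0 = 0 -> y 0 = 0 ->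
  binp (bmul x y) q = \sum_(p <- dv P q) binp x p * binp y (q - p).
Proof.
move=> x0 y0; apply: poly_nat_ext => n; rewrite binpE bin_nat ?bmul0 // bmulE exprMn.
rewrite -!bin_nat // hcoefM horner_sum.
by apply: eq_bigr => p _; rewrite hornerM !binpE.
Qed.

Lemma bin_bmul a x y : x 0 = 0 -> y 0 = 0 -> bin a (bmul x y) = bin a x * bin a y.
Proof.
move=> x0 y0; apply: hserP => q; rewrite -binpE binp_bmul // horner_sum hcoefM.
by apply: eq_bigr => p _; rewrite hornerM !binpE.
Qed.

(** Linear coefficients are compared in [binp_bmul]; the constant coefficients of [binp] are those
    of [(1 + x)^0 = 1], so a product contributes the sum of the linear parts. *)
Lemma hlog_bmul x y : x 0 = 0 -> y 0 = 0 -> hlog (bmul x y) = hlog x + hlog y.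
Proof.
move=> x0 y0; apply: hserP => q; rewrite -[in RHS](mulr1 (hlog x)) -[in RHS](mul1r (hlog y)).
rewrite hlogE binp_bmul // coef_sum hcoefD !hcoefM -big_split /=.
have b0 u p : u 0 = 0 -> (binp u p)`_0 = (1 : B) p.
  by move=> u0; rewrite -horner_coef0 binpE bin0.
apply: eq_bigr => p _; rewrite coefM !big_ord_recl big_ord0 /= addr0 addrC.
by rewrite !b0 // !hlogE.
Qed.

Lemma binD a b x : x 0 = 0 -> bin (a + b) x = bin a x * bin b x.
Proof.
(* [L c q] and [M c q] are the two sides as polynomials in the first exponent. Interpolation at
   naturals first settles a natural [c] with any first exponent; after swapping the exponents this
   supplies the naturals needed for an arbitrary [c]. *)
move=> x0; pose L c q : {poly F} := binp x q \Po ('X + c%:P).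
have LE c q d : (L c q).[d] = bin (d + c) x q.
  by rewrite horner_comp !hornerE binpE.
pose M c q : {poly F} := \sum_(p <- dv P q) bin c x (q - p) *: binp x p.
have ME c q d : (M c q).[d] = (bin d x * bin c x) q.
  rewrite horner_sum hcoefM; apply: eq_bigr => p _.
  by rewrite hornerZ binpE mulrC.
have step c q : (forall n : nat, bin (n%:R + c) x = bin n%:R x * bin c x) ->
    L c q = M c q.
  by move=> nc; apply: poly_nat_ext => n; rewrite LE ME nc.
have LM (n : nat) q : L n%:R q = M n%:R q.
  by apply: step => k; rewrite -natrD !bin_nat // exprD.
apply: hserP => q; rewrite -LE (step b) ?ME // => n; apply: hserP => r.
by rewrite addrC mulrC -LE LM ME.
Qed.

Lemma geomK x : x 0 = 0 -> (1 - x) * (1 + geom x) = 1.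
Proof.
move=> x0; apply: hserP => q; have cD := cont_mull (1 - x).
pose N := size (dv P q).
(* Only divisors of [q] matter, so a finite geometric sum with [N] terms may be used; the remainder
   [x^N] vanishes at [q]. *)
rewrite (cont_local (v := \sum_(k < N) x ^+ k) cD); last first.
  move=> p pq; rewrite hcoefD (psappE _ x0 (leq_size_dv pq)) hcoef_sum.
  rewrite /N; have : (0 < size (dv P q))%N by case: (dv P q) pq.
  case: (size _) => // n _; rewrite !big_ord_recl /= mul0r add0r expr0; congr (_ + _).
  by apply: eq_bigr => i _; rewrite mul1r.
rewrite -opprB mulNr -subrX1 opprB hcoefB (coefX_eq0 (k := N)) ?subr0 //.
Qed.

Lemma geom_uniq x y : x 0 = 0 -> (1 - x) * (1 + y) = 1 -> y = geom x.
Proof.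
move=> x0 xy; have g := geomK x0; apply: (addrI 1).
have -> : 1 + y = (1 - x) * (1 + geom x) * (1 + y) by rewrite g mul1r.
by rewrite mulrAC xy mul1r.
Qed.

Lemma geom0 x : x 0 = 0 -> geom x 0 = 0.
Proof. by move=> x0; apply: psapp0. Qed.

End Binomial.

(** * Composition operators *)

Section Composition.
Variables (P : lfmonoid mono) (K : nat).
Local Notation B := (hser P R).

Definition ellm (j : nat) : mono := (0, fun i => if i == j then 1 else 0).
Definition zmono : mono := (1, fun _ => 0).

Hypothesis ellP : forall j, (j < K)%N -> P (ellm j).

Implicit Types (x y u v : B) (c d : R).

Lemma ellm_neq0 j : ellm j != 0.
Proof.
apply/eqP => /(congr1 (fun m : mono => m.2 j)) /=; rewrite eqxx => /eqP.
by rewrite oner_eq0.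
Qed.

Lemma ellM0 j u : (j < K)%N -> (hmon P R (ellm j) * u) 0 = 0.
Proof.
by move=> /ellP Pj; rewrite hcoefM0 hmonE // eq_sym (negPf (ellm_neq0 j)) mul0r.
Qed.

(* For g = c z (1 + x), dl c x j and uval c x m stand for delta g j and for
   mono_comp m g divided by the monomial m. *)
Fixpoint dl c x (j : nat) : B :=
  match j with
  | 0 => geom (hmon P R (ellm 0) * (ln c *: 1 + hlog x))
  | j'.+1 => geom (hmon P R (ellm j'.+1) * hlog (dl c x j'))
  end.

Lemma dl0 c x j : (j < K)%N -> dl c x j 0 = 0.
Proof. by case: j => [|j] jK; apply: geom0; apply: ellM0. Qed.

Definition uval c x (m : mono) : B :=
  Rpower c m.1 *: (bin m.1 x * \prod_(j < K) bin (m.2 j)%:~R (dl c x j)).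

Lemma uvalD c x m1 m2 : x 0 = 0 -> uval c x (m1 + m2) = uval c x m1 * uval c x m2.
Proof.
move=> x0; rewrite /uval /= Rpower_plus -[Rmult _ _]/(_ * _ : R) binD //.
have -> : \prod_(j < K) bin (m1.2 j + m2.2 j)%:~R (dl c x j) =
   \prod_(j < K) bin (m1.2 j)%:~R (dl c x j) * \prod_(j < K) bin (m2.2 j)%:~R (dl c x j).
  by rewrite -big_split; apply: eq_bigr => j _; rewrite intrD binD // dl0.
by rewrite -scalerAl -scalerAr scalerA; congr (_ *: _); ring.
Qed.

Lemma uval0 c x : 0 < c -> x 0 = 0 -> uval c x 0 = 1.
Proof.
move=> /RltP c0 x0; rewrite /uval /= Rpower_O // scale1r bin0 // mul1r big1 // => j _.
by rewrite bin0 // dl0.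
Qed.

Lemma uval_coef0 c x m : x 0 = 0 -> uval c x m 0 = Rpower c m.1.
Proof.
move=> x0; rewrite hcoefZ hcoefM0 bin_coef0 // mul1r.
have -> : (\prod_(j < K) bin (m.2 j)%:~R (dl c x j)) 0 = 1; last by rewrite mulr1.
apply: (big_ind (fun w : B => w 0 = 1)) => [|u v u0 v0|j _].
- by rewrite hcoef1 eqxx.
- by rewrite hcoefM0 u0 v0 mulr1.
- by rewrite bin_coef0 // dl0.
Qed.

Lemma uval_z c x : 0 < c -> x 0 = 0 -> uval c x zmono = c *: (1 + x).
Proof.
move=> /RltP c0 x0; rewrite /uval /= Rpower_1 // bin1 // big1 ?mulr1 // => j _.
by rewrite bin0 // dl0.
Qed.

Lemma uval_ell c x j : 0 < c -> x 0 = 0 -> (j < K)%N ->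
  uval c x (ellm j) = 1 + dl c x j.
Proof.
move=> /RltP c0 x0 jK; rewrite /uval /= Rpower_O // scale1r bin0 // mul1r.
rewrite (bigD1 (Ordinal jK)) //= eqxx bin1 ?dl0 // big1 ?mulr1 // => i ij.
have -> : (i == j :> nat) = false.
  by apply: contraNF ij => /eqP ij; apply/eqP/val_inj.
by rewrite bin0 ?dl0.
Qed.

(** Right composition with [g = c z (1 + x)] on series supported in [P]. *)
Definition csub c x := hsubst (uval c x).

Lemma csub_cont c x : cont (csub c x).
Proof. exact: cont_hsubst. Qed.

Lemma csub_mon c x p : P p -> csub c x (hmon P R p) = hmon P R p * uval c x p.
Proof. exact: hsubst_mon. Qed.

Lemma csubM c x : x 0 = 0 -> {morph csub c x : u v / u * v}.
Proof. by move=> x0; apply: hsubstM => p q _ _; apply: uvalD. Qed.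

Lemma csub1 c x : 0 < c -> x 0 = 0 -> csub c x 1 = 1.
Proof. by move=> c0 x0; apply: hsubst1; apply: uval0. Qed.

Lemma csub0 c x u : u 0 = 0 -> csub c x u 0 = 0.
Proof. by move=> u0; rewrite /csub hsubst0 u0 mul0r. Qed.

Lemma csub_psapp c x (a : nat -> R) u : 0 < c -> x 0 = 0 -> u 0 = 0 ->
  csub c x (psapp a u) = psapp a (csub c x u).
Proof.
move=> c0 x0 u0; apply: cont_psapp => //; [exact: csub_cont|exact: csubM|exact: csub1].
Qed.

Section Cocycle.
Variables (cg ch : R) (xg xh : B).
Hypotheses (cg0 : 0 < cg) (ch0 : 0 < ch) (xg0 : xg 0 = 0) (xh0 : xh 0 = 0).
Local Notation T := (csub ch xh).
Local Notation xgh := (bmul xh (T xg)).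

(** [xgh] comes from [g o h = cg ch z (1 + xh)(1 + T xg)]. *)
Lemma xgh0 : xgh 0 = 0.
Proof. by apply: bmul0 => //; apply: csub0. Qed.

Lemma csub_geom_ell j v : (j < K)%N ->
  T (geom (hmon P R (ellm j) * v)) = geom (hmon P R (ellm j) * (1 + dl ch xh j) * T v).
Proof.
move=> jK; rewrite (csub_psapp _ ch0 xh0 (ellM0 v jK)) (csubM ch xh0).
by rewrite (csub_mon _ _ (ellP jK)) (uval_ell ch0 xh0 jK).
Qed.

(* If 1 + d = 1/(1 - e v) and 1 + d' = 1/(1 - e (1 + d) v'), then
   (1 + d)(1 + d') = 1/(1 - e (v + v')). *)
Lemma dl_step j v v' : (j < K)%N -> dl ch xh j = geom (hmon P R (ellm j) * v) ->
  dl cg xg j = geom (hmon P R (ellm j) * v') ->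
  bmul (dl ch xh j) (T (dl cg xg j)) = geom (hmon P R (ellm j) * (v + T v')).
Proof.
move=> jK dh dg; apply: geom_uniq; first exact: ellM0.
have k1 := geomK (ellM0 v jK); rewrite -dh in k1.
have k2 : (1 - hmon P R (ellm j) * (1 + dl ch xh j) * T v') * (1 + T (dl cg xg j)) = 1.
  by rewrite dg csub_geom_ell //; apply: geomK; rewrite -mulrA ellM0.
rewrite bmulE.
transitivity (((1 - hmon P R (ellm j) * v) * (1 + dl ch xh j)
   - hmon P R (ellm j) * (1 + dl ch xh j) * T v') * (1 + T (dl cg xg j))); first by ring.
by rewrite k1 k2.
Qed.

(** The chain rule for iterated logarithms: at level 0 the terms [ln c + log(1 + x)] add up under
    composition, and at each later level the logarithms of the previous factors do. *)
Lemma dl_cocycle j : (j < K)%N ->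
  dl (cg * ch) xgh j = bmul (dl ch xh j) (T (dl cg xg j)).
Proof.
elim: j => [|j IH] jK.
  rewrite (dl_step jK (erefl _) (erefl _)) /=; congr (geom (_ * _)).
  rewrite hlog_bmul //; last exact: csub0.
  have -> : ln (cg * ch) = ln cg + ln ch by apply: ln_mult; apply/RltP.
  rewrite (cont_add _ _ (csub_cont _ _)) (cont_scale _ _ (csub_cont _ _)) csub1 //.
  by rewrite csub_psapp // scalerDl -/(hlog _); ring.
have jK' : (j < K)%N := ltnW jK.
rewrite (dl_step jK (erefl _) (erefl _)) [LHS]/= IH //; congr (geom (_ * _)).
by rewrite hlog_bmul ?dl0 ?csub0 ?dl0 // csub_psapp ?dl0.
Qed.

Lemma uval_cocycle m : uval (cg * ch) xgh m = uval ch xh m * T (uval cg xg m).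
Proof.
rewrite /uval (cont_scale _ _ (csub_cont _ _)) csubM //.
rewrite (big_morph (csub ch xh) (csubM ch xh0) (csub1 ch0 xh0)).
rewrite bin_bmul //; last exact: csub0.
have -> : \prod_(j < K) bin (m.2 j)%:~R (dl (cg * ch) xgh j) =
   \prod_(j < K) bin (m.2 j)%:~R (dl ch xh j) *
   \prod_(j < K) csub ch xh (bin (m.2 j)%:~R (dl cg xg j)).
  rewrite -big_split; apply: eq_bigr => j _.
  by rewrite dl_cocycle // bin_bmul ?dl0 ?csub0 ?dl0 // [csub _ _ (bin _ _)]csub_psapp // dl0.
rewrite [csub _ _ (bin _ _)]csub_psapp // -/(bin _ _).
have -> : Rpower (cg * ch) m.1 = Rpower cg m.1 * Rpower ch m.1.
  by symmetry; apply: Rpower_mult_distr; apply/RltP.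
rewrite -scalerAl -scalerAr scalerA [in RHS](mulrC (Rpower ch _)); congr (_ *: _).
by ring.
Qed.

End Cocycle.

(* tsub is composition with g on series z u, divided by z. *)
Definition tsub c x := hsubst (fun p => uval c x (zmono + p)).

Lemma tsub_cont c x : cont (tsub c x).
Proof. exact: cont_hsubst. Qed.

Lemma tsub_mon c x p : P p -> tsub c x (hmon P R p) = hmon P R p * uval c x (zmono + p).
Proof. by move=> Pp; rewrite [LHS]hsubst_mon. Qed.

Lemma tsubE c x u : x 0 = 0 -> tsub c x u = uval c x zmono * csub c x u.
Proof.
move=> x0; move: u.
apply: (cont_ext (tsub_cont c x) (cont_comp (cont_mull _) (csub_cont c x))) => p Pp.
by rewrite (tsub_mon _ _ Pp) (csub_mon _ _ Pp) uvalD //; ring.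
Qed.

Lemma tsub_comp (cg ch : R) (xg xh u : B) :
  0 < cg -> 0 < ch -> xg 0 = 0 -> xh 0 = 0 ->
  tsub ch xh (tsub cg xg u) = tsub (cg * ch) (bmul xh (csub ch xh xg)) u.
Proof.
move=> cg0 ch0 xg0 xh0; move: u.
apply: (cont_ext (cont_comp (tsub_cont _ _) (tsub_cont _ _)) (tsub_cont _ _)) => p Pp /=.
rewrite (tsub_mon cg xg Pp) (tsub_mon _ _ Pp) (uval_cocycle cg0 ch0 xg0 xh0).
rewrite (tsubE ch _ xh0) (csubM ch xh0) (csub_mon _ _ Pp).
by rewrite (uvalD ch zmono p xh0); ring.
Qed.

Lemma tsub_affine c d x y : 0 < d -> y 0 = 0 ->
  tsub d y (c *: (1 + x)) = (c * d) *: (1 + bmul y (csub d y x)).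
Proof.
move=> d0 y0; rewrite tsubE // uval_z // (cont_scale _ _ (csub_cont _ _)).
rewrite (cont_add _ _ (csub_cont _ _)) csub1 // bmulE -scalerAl -scalerAr scalerA.
by rewrite mulrC.
Qed.

Lemma dl_ideal (I : set mono) c x y j : (forall a b, I a -> P b -> I (a + b)) ->
  hideal I (x - y) -> hideal I (dl c x j - dl c y j).
Proof.
move=> IP Ixy; elim: j => [|j IH] /=; apply: hideal_psapp => //; apply: hideal_subM => //.
- by rewrite subrr; apply: hideal0.
- by rewrite opprD addrACA subrr add0r; apply: hideal_psapp.
- by rewrite subrr; apply: hideal0.
- exact: hideal_psapp.
Qed.

(** [uval] is built from [x] by products and power series, which preserve congruence. This bounds
    from below how far the difference of two composition operators raises monomials. *)
Lemma uval_ideal (I : set mono) c x y m : (forall a b, I a -> P b -> I (a + b)) ->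
  hideal I (x - y) -> hideal I (uval c x m - uval c y m).
Proof.
move=> IP Ixy; rewrite /uval -scalerBr; apply: hidealZ; apply: hideal_subM => //.
  exact: hideal_psapp.
apply: (big_ind2 (fun u v : B => hideal I (u - v))) => [|a b a' b' ha hb|j _].
- by rewrite subrr; apply: hideal0.
- exact: hideal_subM.
- by apply: hideal_psapp => //; apply: dl_ideal.
Qed.

End Composition.

(** * Translation of raw coefficient functions into the algebra over [P] *)

Section Embedding.
Variables (P : lfmonoid mono) (K : nat).
Hypothesis ellP : forall j, (j < K)%N -> P (ellm j).
Hypothesis levP : forall m, P m -> forall j, (K <= j)%N -> m.2 j = 0.
Local Notation B := (hser P R).
Implicit Types (x y u : B) (c : R) (v w m : mono).

(** The series [v x], with the monomial [v] possibly outside [P]; transseries with leading monomial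
    [z] appear with [v = zmono]. *)
Definition emb v x : series := fun m => x (m - v).

Lemma emb_inj v : injective (emb v).
Proof.
move=> x y xy; apply: hserP => m.
by have := congr1 (fun s : series => s (m + v)) xy; rewrite /emb addrK.
Qed.

Lemma smul_emb v w x y : smul (emb v x) (emb w y) = emb (v + w) (x * y).
Proof.
apply/funext => m; rewrite /emb hcoefM.
rewrite [LHS](fsum_uniq_supp (s := [seq p + v | p <- dv P (m - (v + w))])).
- rewrite big_map; apply: eq_bigr => p _; rewrite addrK; congr (_ * y _).
  by rewrite -[msub _ _]/(m - (p + v)) !opprD !addrA [m - v - w - p]addrAC [m - v - p]addrAC.
- by rewrite map_inj_uniq ?dv_uniq // => a b /addIr.
move=> m1; rewrite mulf_eq0 negb_or => /andP[/hser_in P1 /hser_in P2].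
apply/mapP; exists (m1 - v); last by rewrite subrK.
apply/dvP; split => //; rewrite (_ : _ - _ = msub m m1 - w) //.
by rewrite -[msub _ _]/(m - m1) opprB !opprD !addrA [m - v - w + v]addrAC subrK addrAC.
Qed.

Lemma mon_emb v : mon v = emb v (1 : B).
Proof.
apply/funext => m; rewrite /emb /mon hcoef1 subr_eq0.
by case: pselect => [mv|mv] /=; [rewrite mv eqxx | move/eqP/negPf: mv => ->].
Qed.

Lemma sone_emb : sone = emb 0 (1 : B).
Proof. exact: mon_emb. Qed.

Lemma sscale_emb c v x : sscale c (emb v x) = emb v (c *: x).
Proof. by apply/funext => m; rewrite /emb hcoefZ. Qed.

Lemma sadd_emb v x y : sadd (emb v x) (emb v y) = emb v (x + y).
Proof. by apply/funext => m; rewrite /emb hcoefD. Qed.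

Lemma spow_emb x k : spow (emb 0 x) k = emb 0 (x ^+ k).
Proof.
elim: k => [|k IH]; first exact: sone_emb.
by rewrite /spow iterS -/(spow _ _) IH smul_emb addr0 exprS.
Qed.

Lemma ssum_psapp (a : nat -> R) x (A : nat -> series) : x 0 = 0 ->
  (forall k m, A k m = a k * (x ^+ k) m) -> ssum A = emb 0 (psapp a x).
Proof.
move=> x0 AE; apply/funext => m; rewrite /emb subr0 psappE_size /ssum.
rewrite (fsum_uniq_supp (s := iota 0 (size (dv P m)))) ?iota_uniq //.
  by rewrite -[size _]subn0 -/(index_iota _ _) subn0 big_mkord; apply: eq_bigr => i _; rewrite AE.
move=> k; rewrite AE mem_iota /= add0n; apply: contraTT; rewrite -leqNgt => mk.
by rewrite coefX_eq0 // mulr0 eqxx.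
Qed.

Lemma ssum_psappS (a : nat -> R) x (A : nat -> series) : x 0 = 0 -> a 0 = 0 ->
  (forall k m, A k m = a k.+1 * (x ^+ k.+1) m) -> ssum A = emb 0 (psapp a x).
Proof.
move=> x0 a0 AE; apply/funext => m; rewrite /emb subr0.
(* The truncation takes one extra term to make up for the index shift, since the term at 0 is split
   off and vanishes. *)
rewrite (psappE _ (N := (size (dv P m)).+1) x0) // big_ord_recl a0 mul0r add0r.
rewrite /ssum (fsum_uniq_supp (s := iota 0 (size (dv P m)))) ?iota_uniq //.
  by rewrite -[size _]subn0 -/(index_iota _ _) subn0 big_mkord; apply: eq_bigr => i _; rewrite AE.
move=> k; rewrite AE mem_iota /= add0n; apply: contraTT; rewrite -leqNgt => mk.
by rewrite coefX_eq0 ?mulr0 ?eqxx // leqW.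
Qed.

Lemma binser_emb a x : x 0 = 0 -> binser a (emb 0 x) = emb 0 (bin a x).
Proof.
move=> x0; apply: ssum_psapp => // k m.
by rewrite spow_emb sscale_emb /emb subr0 hcoefZ gpoly_horner.
Qed.

Lemma logser_emb x : x 0 = 0 -> logser (emb 0 x) = emb 0 (hlog x).
Proof.
move=> x0; apply: ssum_psappS => //; first by rewrite /gpoly big_ord0 coefZ coef1 mulr0.
by move=> k m; rewrite spow_emb sscale_emb /emb subr0 hcoefZ gpoly_coef1.
Qed.

Lemma geom1_emb x : x 0 = 0 -> geom1 (emb 0 x) = emb 0 (geom x).
Proof.
move=> x0; apply: ssum_psappS => // k m.
by rewrite spow_emb /emb subr0 mul1r.
Qed.

Lemma ell_emb j : (j < K)%N -> ell j = emb 0 (hmon P R (ellm j)).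
Proof.
move=> jK; apply/funext => m; rewrite /emb subr0 hmonE; last exact: ellP.
by rewrite /ell /mon; case: pselect => [mv|mv] /=; [rewrite mv eqxx | move/eqP/negPf: mv => ->].
Qed.

(** It holds for an arbitrary series, which covers the levels [j >= K], where [delta g j] need not
    be supported in [P]. *)
Lemma binser0 s : binser 0 s = sone.
Proof.
apply/funext => m; rewrite /binser /ssum (fsum_uniq_supp (s := [:: 0%N])) //.
  have g0 : gbinom 0 0 = 1 by rewrite /gbinom big_ord0 fact0; apply: divr1.
  by rewrite big_seq1 /sscale g0; apply: mul1r.
move=> [|k] //; have g0 : gbinom 0 k.+1 = 0.
  by rewrite /gbinom big_ord_recl subr0 mul0r; apply: mul0r.
by rewrite /sscale g0 [X in X != 0]mul0r eqxx.
Qed.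

Lemma nboundP (n : nat -> int) : (exists N, forall j, (N <= j)%N -> n j = 0) ->
  forall j, (nbound n <= j)%N -> n j = 0.
Proof. by rewrite /nbound => nN; case: pselect => // N; case: cid. Qed.

Section Rep.
Variables (g : series) (c : R) (x : B).
Hypotheses (c0 : 0 < c) (x0 : x 0 = 0) (gE : g = emb zmono (c *: (1 + x))).

Lemma lcoef_rep : lcoef g = c.
Proof. by rewrite /lcoef gE /emb subrr hcoefZ hcoefD x0 hcoef1 eqxx addr0 mulr1. Qed.

Lemma eps_rep : eps g = emb 0 x.
Proof.
apply/funext => m; rewrite /eps lcoef_rep /emb subr0.
case: pselect => [m0|m0] /=; first by rewrite m0 x0.
move/eqP: m0 => m0.
have -> : (m.1 + 1, m.2) = m + zmono.
  by congr pair; apply/funext => j; symmetry; apply: addr0.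
rewrite gE /emb addrK.
by rewrite hcoefZ hcoefD hcoef1 (negPf m0) add0r mulrC mulKf // gt_eqF.
Qed.

Lemma delta_rep j : (j < K)%N -> delta g j = emb 0 (dl c x j).
Proof.
elim: j => [|j IH] jK /=.
  rewrite eps_rep lcoef_rep logser_emb // sone_emb sscale_emb sadd_emb ell_emb //.
  by rewrite smul_emb addr0 geom1_emb // (ellM0 ellP).
rewrite IH ?(ltnW jK) // logser_emb ?(dl0 ellP) ?(ltnW jK) // ell_emb // smul_emb addr0.
by rewrite geom1_emb // (ellM0 ellP).
Qed.

Lemma mono_comp_rep m : (forall j, (K <= j)%N -> m.2 j = 0) ->
  mono_comp m g = emb m (uval K c x m).
Proof.
move=> mK; rewrite /mono_comp eps_rep lcoef_rep binser_emb // sscale_emb.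
pose W j : B := if (j < K)%N then bin (m.2 j)%:~R (dl c x j) else 1.
have mn : forall j, (nbound m.2 <= j)%N -> m.2 j = 0 by apply: nboundP; exists K.
have W1 j : m.2 j = 0 -> W j = 1.
  by rewrite /W => ->; case: ifP => // jK; rewrite bin0 // (dl0 ellP).
set pr := \big[_/_]_(_ < _) _.
have -> : pr = emb 0 (\prod_(j < nbound m.2) W j).
  rewrite /pr; apply: (big_ind2 (fun (s : series) (w : B) => s = emb 0 w)) => [|s w s' w' -> ->|j _].
  - exact: sone_emb.
  - by rewrite smul_emb addr0.
  rewrite /W; case: ltnP => [jK|/mK ->]; last by rewrite binser0 sone_emb.
  by rewrite delta_rep // binser_emb // (dl0 ellP).
rewrite (mon_emb m) !smul_emb !addr0 mul1r; congr (emb _ _).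
rewrite /uval -scalerAl; congr (_ *: (_ * _)).
(* [nbound m.2] is some chosen bound, possibly on either side of [K]; both products extend to the
   maximum by factors 1. *)
pose N := maxn (nbound m.2) K.
have -> : \prod_(j < nbound m.2) W j = \prod_(j < N) W j.
  rewrite (big_ord_widen N W (leq_maxl _ _)) big_mkcond; apply: eq_bigr => j _.
  by case: ltnP => // /mn /W1.
have -> : \prod_(j < K) bin (m.2 j)%:~R (dl c x j) = \prod_(j < K) W j.
  by apply: eq_bigr => j _; rewrite /W ltn_ord.
rewrite [RHS](big_ord_widen N W (leq_maxr _ _)) [RHS]big_mkcond; apply: eq_bigr => j _.
by case: ltnP => // /mK /W1.
Qed.

Lemma tcomp_rep u : tcomp (emb zmono u) g = emb zmono (tsub K c x u).
Proof.
apply/funext => m; rewrite /emb /tsub hsubstE.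
have lev p : P p -> forall j, (K <= j)%N -> (zmono + p).2 j = 0.
  by move=> Pp j jK; rewrite -[LHS]/(0 + p.2 j) (levP Pp jK) addr0.
rewrite [LHS](fsum_uniq_supp (s := [seq zmono + p | p <- dv P (m - zmono)])).
- rewrite big_map; apply: eq_big_seq => p /dvP[Pp _].
  rewrite mono_comp_rep; last exact: lev.
  by rewrite /emb [zmono + p]addrC addrK opprD addrA addrAC.
- by rewrite map_inj_uniq ?dv_uniq // => a b /addrI.
move=> m1; rewrite mulf_eq0 negb_or => /andP[/hser_in P1].
have m1E : m1 = zmono + (m1 - zmono) by rewrite addrC subrK.
rewrite mono_comp_rep; last by rewrite m1E; apply: lev.
move=> /hser_in P2; rewrite m1E; apply: map_f; apply/dvP; split=> //.
by rewrite opprB addrA subrK.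
Qed.

End Rep.

Lemma rep_exists (g : series) c : c != 0 -> lead_term_z c g ->
  (forall m, g m != 0 -> P (m - zmono)) ->
  exists x : B, x 0 = 0 /\ g = emb zmono (c *: (1 + x)).
Proof.
move=> c0 [gz _] gP.
pose y : B := mkh P (fun p => g (p + zmono)).
have yE p : y p = g (p + zmono).
  rewrite mkhE // => q Pq; apply: contrapT => /eqP /gP; rewrite addrK //.
exists (c^-1 *: y - 1); split.
  by rewrite hcoefB hcoefZ yE add0r [g zmono]gz hcoef1 eqxx mulVf ?subrr.
rewrite addrC subrK scalerA divff // scale1r.
by apply/funext => m; rewrite /emb yE subrK.
Qed.

Lemma rep_lead c x : x 0 = 0 -> (c *: (1 + x)) 0 = c.
Proof. by move=> x0; rewrite hcoefZ hcoefD hcoef1 x0 eqxx addr0 mulr1. Qed.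

End Embedding.

(** * Neumann's lemma *)

(** All exponents are real numbers here, with that of [z] first, so that [mle] becomes one uniform
    lexicographic comparison. *)
Definition mcoord (i : nat) (m : mono) : R := if i is i'.+1 then (m.2 i')%:~R else m.1.

Lemma mcoordD i a b : mcoord i (a + b) = mcoord i a + mcoord i b.
Proof. by case: i => //= i; rewrite -[LHS]/((a.2 i + b.2 i)%:~R) intrD. Qed.

Lemma mcoord0 i : mcoord i 0 = 0.
Proof. by case: i. Qed.

Lemma mcoord_sum i (s : seq mono) : mcoord i (\sum_(a <- s) a) = \sum_(a <- s) mcoord i a.
Proof. exact: (big_morph _ (mcoordD i) (mcoord0 i)). Qed.

Lemma mcoord_inj a b : (forall i, mcoord i a = mcoord i b) -> a = b.
Proof.
case: a b => [a1 a2] [b1 b2] ab; have := ab 0%N => /= ->; congr pair.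
by apply/funext => i; apply/eqP; rewrite -(eqr_int R); apply/eqP; apply: (ab i.+1).
Qed.

Lemma mleP a b : mle a b <->
  a = b \/ exists j, mcoord j a < mcoord j b /\ forall i, (i < j)%N -> mcoord i a = mcoord i b.
Proof.
case: a b => [a1 a2] [b1 b2]; split.
  case=> /= [lt1|[<- [<-|[j [ltj eqj]]]]]; [by right; exists 0%N|by left|right].
  exists j.+1 => /=; rewrite ltr_int; split => // -[|i] //=.
  by rewrite ltnS => /eqj ->.
case=> [[-> ->]|[[|j] [ltj eqj]]]; first by right; split => //; left.
  by left.
right; split; first exact: (eqj 0%N).
right; exists j; split; first by move: ltj; rewrite /= ltr_int.
by move=> i ij; apply/eqP; rewrite -(eqr_int R); apply/eqP; apply: (eqj i.+1).
Qed.

Lemma mle_refl a : mle a a.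
Proof. by right; split=> //; left. Qed.

Lemma mle_total a b : mle a b \/ mle b a.
Proof.
have [/mcoord_inj ->|] := pselect (forall i, mcoord i a = mcoord i b); first by left; apply: mle_refl.
move/existsNP => [i0 /eqP i0P].
have ex : exists i, mcoord i a != mcoord i b by exists i0.
case: (ex_minnP ex) => j jne jmin.
have eqj i : (i < j)%N -> mcoord i a = mcoord i b.
  by move=> ij; apply/eqP/negPn/negP => /jmin; rewrite leqNgt ij.
by move: jne; rewrite neq_lt => /orP[lt|lt]; [left|right]; apply/mleP; right; exists j;
  split=> // i /eqj.
Qed.

Lemma mle_anti a b : mle a b -> mle b a -> a = b.
Proof.
move=> /mleP[//|[j [ltj eqj]]] /mleP[//|[i [lti eqi]]].
have [ij|ji|ij] := ltngtP i j.
- by move: lti; rewrite eqj // ltxx.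
- by move: ltj; rewrite eqi // ltxx.
- by move: lti; rewrite ij => lti; have := lt_trans ltj lti; rewrite ltxx.
Qed.

Lemma mle_trans b a c : mle a b -> mle b c -> mle a c.
Proof.
move=> /mleP[->//|[j [ltj eqj]]] /mleP[<-|[i [lti eqi]]]; apply/mleP; right.
  by exists j.
have [ij|ji|ij] := ltngtP i j.
- exists i; rewrite eqj //; split=> // l li; rewrite eqj ?eqi //; exact: ltn_trans ij.
- exists j; rewrite -eqi //; split=> // l lj; rewrite eqj ?eqi //; exact: ltn_trans ji.
- exists j; rewrite ij in lti eqi; split; first exact: lt_trans ltj lti.
  by move=> l lj; rewrite eqj ?eqi.
Qed.

Lemma mle_add2r c a b : mle a b -> mle (a + c) (b + c).
Proof.
move=> /mleP[->|[j [ltj eqj]]]; first exact: mle_refl.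
apply/mleP; right; exists j; rewrite !mcoordD ltrD2r; split=> // i /eqj.
by rewrite !mcoordD => ->.
Qed.

Lemma mleD a b c d : mle a b -> mle c d -> mle (a + c) (b + d).
Proof.
move=> /(mle_add2r c) ab /(mle_add2r b) cd; apply: mle_trans ab _.
by rewrite addrC [b + d]addrC.
Qed.

Lemma mle_subr a b : mle a b -> mle 0 (b - a).
Proof. by move/(mle_add2r (- a)); rewrite subrr. Qed.

Lemma mleN a b : mle a b -> mle (- b) (- a).
Proof. by move/(mle_add2r (- a - b)); rewrite addrA subrr sub0r addrC subrK. Qed.

Definition mlt a b := mle a b /\ a <> b.

Lemma nmle_lt a b : ~ mle a b -> mlt b a.
Proof.
move=> nab; have [//|ba] := mle_total a b; split=> // e.
by apply: nab; rewrite e; apply: mle_refl.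
Qed.

Lemma wo_sub (A C : set mono) : A `<=` C -> well_ordered C -> well_ordered A.
Proof. by move=> AC wC D DA; apply: wC => d /DA /AC. Qed.

Lemma woU (A C : set mono) : well_ordered A -> well_ordered C -> well_ordered (A `|` C).
Proof.
move=> wA wC D DAC [d0 Dd0].
have [[a [Da Aa]]|nA] := pselect ((D `&` A) !=set0); last first.
  apply: (wC D); last by exists d0.
  by move=> d Dd; have [Ad|//] := DAC d Dd; case: nA; exists d.
have [[c [Dc Cc]]|nC] := pselect ((D `&` C) !=set0); last first.
  apply: (wA D); last by exists d0.
  by move=> d Dd; have [//|Cd] := DAC d Dd; case: nC; exists d.
have [|a' [Da' _] mina] := wA (D `&` A) (fun _ h => h.2); first by exists a.
have [|c' [Dc' _] minc] := wC (D `&` C) (fun _ h => h.2); first by exists c.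
have [le|le] := mle_total a' c'; [exists a'|exists c'] => // d Dd; have [Ad|Cd] := DAC d Dd.
- exact: mina.
- by apply: mle_trans le _; apply: minc.
- by apply: mle_trans le _; apply: mina.
- exact: minc.
Qed.

Lemma wo1 a : well_ordered [set a].
Proof. by move=> D Da [d Dd]; exists d => // d' Dd'; rewrite (Da _ Dd) (Da _ Dd'); apply: mle_refl. Qed.

Definition msum (A C : set mono) : set mono := [set m | exists a c, [/\ A a, C c & m = a + c]].

Lemma wo_msum (A C : set mono) : well_ordered A -> well_ordered C -> well_ordered (msum A C).
Proof.
move=> wA wC D DAC [d0 Dd0].
(* a is in T when, for some c, no pair with sum at most a + c has a smaller second
   component than c; the least a in T gives the least sum. *)
pose T := [set a | A a /\ exists c, [/\ C c, D (a + c) &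
  forall a' c', A a' -> C c' -> D (a' + c') -> mle (a' + c') (a + c) -> mle c c']].
pose least (U : set mono) := fun a c => [/\ A a, C c, U (a + c) &
  forall a' c', A a' -> C c' -> U (a' + c') -> mle c c'].
have leastP (U : set mono) : U `<=` D -> U !=set0 -> exists a c, least U a c.
  move=> UD [u Uu]; have [a [c [Aa Cc uE]]] := DAC u (UD u Uu).
  have [||c' [a' [Aa' Cc' Uac']] minc'] := wC [set c | exists a, [/\ A a, C c & U (a + c)]].
  - by move=> c' [a' []].
  - by exists c, a; rewrite -uE.
  by exists a', c'; split=> // a1 c1 A1 C1 U1; apply: minc'; exists a1.
have [|a [Aa [c [Cc Dac minc]]] mina] := wA T (fun a Ta => Ta.1).
  have [|a [c [Aa Cc Dac minc]]] := leastP D (fun _ h => h); first by exists d0.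
  by exists a; split=> //; exists c; split=> // a' c' Aa' Cc' Dac' _; apply: minc Dac'.
exists (a + c) => // d Dd; apply: contrapT => /nmle_lt [dac dnac].
(* Among the sums strictly below [a + c], a pair with least second component has its first component
   in [T]. Hence [a <= a'] and [c <= c'], which contradicts strictness. *)
have [||a' [c' [Aa' Cc' [Dac' lt'] minc']]] := leastP [set u | D u /\ mlt u (a + c)].
- by move=> u [].
- by exists d.
have Ta' : T a'.
  split=> //; exists c'; split=> // a1 c1 A1 C1 D1 le1; apply: minc' A1 C1 _; split=> //.
  split; first exact: mle_trans le1 lt'.1.
  by move=> e; case: lt' => le' []; apply: mle_anti => //; rewrite -e.
have := mleD (mina _ Ta') (minc _ _ Aa' Cc' Dac' lt'.1) => /mle_anti /(_ lt'.1) e.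
by case: lt' => _ []; rewrite e.
Qed.

(** Since [p |-> q - p] reverses the order, every nonempty subset has both a least and a greatest
    element, which forces finiteness. *)
Lemma wo_fin (A C : set mono) q : well_ordered A -> well_ordered C ->
  finite_set [set p | A p /\ C (q - p)].
Proof.
move=> wA wC; set D := [set p | _]; apply: contrapT => infD.
have wD : well_ordered D by apply: wo_sub wA => p [].
have maxD (E : set mono) : E `<=` D -> E !=set0 -> exists2 m, E m & forall e, E e -> mle e m.
  move=> ED [e0 Ee0].
  have [|| m Em minm] := wC [set c | E (q - c)].
  - by move=> c /ED [_]; rewrite subKr.
  - by exists (q - e0); rewrite /= subKr.
  exists (q - m) => // e Ee; rewrite -[e](subKr q) addrC [q - m]addrC.
  by apply: mle_add2r; apply: mleN; apply: minm; rewrite /= subKr.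
have ne0 (E : set mono) : ~ finite_set E -> E !=set0.
  by move=> iE; apply/set0P/negP => /eqP E0; apply: iE; rewrite E0; apply: finite_set0.
(* The points with infinitely many elements below them. If [x] is the least one, the greatest
   element strictly below [x] is another. *)
pose X := [set x | D x /\ ~ finite_set (D `&` [set p | mle p x])].
have [M DM maxM] := maxD D (fun _ h => h) (ne0 _ infD).
have [|x [Dx infx] minx] := wD X (fun x Xx => Xx.1).
  exists M; split=> //; rewrite (_ : _ `&` _ = D) //.
  by apply/seteqP; split=> [p []//|p Dp]; split=> //; apply: maxM.
pose E := D `&` [set p | mlt p x].
have infE : ~ finite_set E.
  move=> finE; apply: infx; apply: (@sub_finite_set _ _ (E `|` [set x])).
    by move=> p [Dp px]; have [->|npx] := pselect (p = x); [right|left; split=> //; split].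
  by rewrite finite_setU; split.
have [y [Dy [yx ynx]] maxy] := maxD E (fun _ h => h.1) (ne0 _ infE).
apply: ynx; apply: mle_anti => //; apply: minx; split=> // finy; apply: infE.
by apply: sub_finite_set finy => p Ep; split; [case: Ep|apply: maxy].
Qed.

Definition star (S : set mono) : set mono :=
  [set m | exists2 s : seq mono, (forall a, a \in s -> S a) & m = \sum_(a <- s) a].

Lemma star0 S : star S 0.
Proof. by exists [::]; rewrite ?big_nil. Qed.

Lemma starD S a b : star S a -> star S b -> star S (a + b).
Proof.
move=> [s sS ->] [t tS ->]; exists (s ++ t); last by rewrite big_cat.
by move=> c; rewrite mem_cat => /orP[/sS|/tS].
Qed.

Lemma star_sub S : S `<=` star S.
Proof. by move=> a Sa; exists [:: a]; [move=> b; rewrite inE => /eqP ->|rewrite big_seq1]. Qed.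

Lemma star_ind (S Q : set mono) : Q 0 -> (forall a b, Q a -> Q b -> Q (a + b)) ->
  S `<=` Q -> star S `<=` Q.
Proof.
move=> Q0 QD SQ _ [s sS ->]; elim: s sS => [|a s IH] sS; first by rewrite big_nil.
rewrite big_cons; apply: QD; first by apply/SQ/sS; rewrite mem_head.
by apply: IH => b bs; apply: sS; rewrite inE bs orbT.
Qed.

Lemma wo_words (V : set mono) n : well_ordered V -> well_ordered
  [set m | exists s : seq mono, [/\ (size s <= n)%N, forall a, a \in s -> V a & m = \sum_(a <- s) a]].
Proof.
move=> wV; elim: n => [|n IH].
  apply: (wo_sub _ (@wo1 0)) => m [[|a s] [sz _ ->]] //.
  by rewrite big_nil.
apply: (wo_sub _ (woU (@wo1 0) (wo_msum wV IH))) => m [[|a s] [szs sV ->]].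
  by left; rewrite big_nil.
right; rewrite big_cons; exists a, (\sum_(b <- s) b); split=> //.
  by apply: sV; rewrite mem_head.
by exists s; split=> // b bs; apply: sV; rewrite inE bs orbT.
Qed.

(** Generators with nonzero coordinate [j] have it at least some [e > 0], because the earlier
    coordinates vanish. Below a given value of that coordinate a word contains boundedly many of
    them, so it lies in the sum of two well-ordered sets: short words in [V], and words in the
    remaining generators. *)
Lemma wo_star_step (S : set mono) j : well_ordered S ->
  (forall m, S m -> mle 0 m /\ forall i, (i < j)%N -> mcoord i m = 0) ->
  well_ordered (star [set m | S m /\ mcoord j m = 0]) -> well_ordered (star S).
Proof.
move=> wS Spos wS' A AS [a0 Aa0].
have ge0 m : S m -> 0 <= mcoord j m.
  move=> /Spos [/mleP[<-|[i [lti eqi]]] Sm]; first by rewrite mcoord0.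
  rewrite mcoord0 in lti; have [ij|ji|<-] := ltngtP i j; last exact: ltW.
  - by move: lti; rewrite Sm // ltxx.
  - by rewrite -(eqi _ ji) mcoord0.
pose V := [set m | S m /\ mcoord j m != 0].
have wV : well_ordered V by apply: wo_sub wS => m [].
have [e e0 eV] : exists2 e, 0 < e & forall m, V m -> e <= mcoord j m.
  have [Vne|V0] := pselect (V !=set0); last first.
    by exists 1 => // m Vm; case: V0; exists m.
  have [v [Sv v0] minv] := wV V (fun _ h => h) Vne.
  exists (mcoord j v); first by rewrite lt_def v0 ge0.
  move=> m Vm; have /mleP[->//|[i [lti eqi]]] := minv m Vm.
  have [ij|ji|<-] := ltngtP i j; last exact: ltW.
  - by move: lti; rewrite (Spos _ Vm.1).2 // (Spos _ Sv).2 // ltxx.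
  - by rewrite eqi.
have cA i a : A a -> (i < j)%N -> mcoord i a = 0.
  move=> /AS Sa ij; apply: (star_ind (Q := [set m | mcoord i m = 0])) Sa => /=.
  - exact: mcoord0.
  - by move=> x y; rewrite mcoordD => -> ->; rewrite addr0.
  - by move=> m /Spos[_]; apply.
(* Words whose coordinate [j] is at most [c] have fewer than [N] letters in [V]. Elements of [A]
   beyond [c] exceed the minimum sought. *)
pose c := mcoord j a0; pose N := Num.bound (c / e).
have cN : c < N%:R * e.
  rewrite -ltr_pdivrMr //; apply: le_lt_trans (archi_boundP _); first exact: lexx.
  rewrite divr_ge0 ?(ltW e0) //; have := AS _ Aa0.
  apply: (star_ind (Q := [set m | 0 <= mcoord j m])) => //=; first by rewrite mcoord0.
  by move=> x y; rewrite mcoordD => ??; apply: addr_ge0.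
have szV (s : seq mono) : (forall a, a \in s -> V a) ->
    (size s)%:R * e <= \sum_(a <- s) mcoord j a.
  elim: s => [|a s IH] sV; first by rewrite big_nil mul0r.
  rewrite big_cons -natr1 mulrDl mul1r addrC; apply: lerD.
    by apply/eV/sV; rewrite mem_head.
  by apply: IH => d ds; apply: sV; rewrite inE ds orbT.
have wA' : well_ordered [set a | A a /\ mcoord j a <= c].
  apply: (wo_sub _ (wo_msum (@wo_words V N wV) wS')) => _ [/AS[s sS ->] le].
  exists (\sum_(a <- s | mcoord j a != 0) a), (\sum_(a <- s | ~~ (mcoord j a != 0)) a).
  split; last by rewrite [LHS](bigID (fun a => mcoord j a != 0)).
  - rewrite -big_filter; eexists; split; last by [].
      rewrite -ltnS; apply: leqW; rewrite -(ltr_nat R) -(ltr_pM2r e0).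
      apply: le_lt_trans cN; apply: le_trans le; rewrite mcoord_sum.
      rewrite (bigID (fun a => mcoord j a != 0)) /= [X in _ <= _ + X]big1 ?addr0; last first.
        by move=> a /negPn/eqP.
      rewrite -big_filter; apply: szV => a.
      by rewrite mem_filter => /andP[a0' /sS].
    by move=> a; rewrite mem_filter => /andP[a0' /sS].
  - rewrite -big_filter; eexists; last by [].
    by move=> a; rewrite mem_filter => /andP[/negPn/eqP a0' /sS].
have [|m [Am mc] minm] := wA' _ (fun _ h => h); first by exists a0; split=> //=; apply: lexx.
exists m => // a Aa; have [ac|ca] := leP (mcoord j a) c; first exact: minm.
apply/mleP; right; exists j; split; first exact: le_lt_trans mc ca.
by move=> i ij; rewrite !cA.
Qed.

Lemma wo_star (K : nat) (S : set mono) : well_ordered S ->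
  (forall m, S m -> [/\ mle 0 m, m <> 0 & forall j, (K <= j)%N -> m.2 j = 0]) ->
  well_ordered (star S).
Proof.
move=> wS SK.
(* Of the [K + 1] coordinates, [j] already vanish on the generators and [n] remain. When all vanish
   no generator is left, as 0 is excluded. *)
suff : forall n j (S' : set mono), (j + n = K.+1)%N -> S' `<=` S ->
    (forall m, S' m -> forall i, (i < j)%N -> mcoord i m = 0) -> well_ordered (star S').
  by move/(_ K.+1 0%N S); apply.
elim=> [|n IH] j S' jn S'S S'j.
  have S'0 m : ~ S' m.
    move=> S'm; have [_ m0 mK] := SK _ (S'S _ S'm); apply: m0; apply: mcoord_inj => i.
    rewrite mcoord0; have [ij|ji] := ltnP i j; first exact: S'j.
    by case: i ji => [|i] ji; [lia|rewrite /= mK //; lia].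
  apply: (wo_sub _ (@wo1 0)) => m [[|a s] sS' ->]; first by rewrite big_nil.
  by case: (S'0 a); apply: sS'; rewrite mem_head.
apply: (wo_star_step (j := j)).
- exact: wo_sub wS.
- by move=> m S'm; split; [have [] := SK _ (S'S _ S'm)|apply: S'j].
apply: (IH j.+1); first by lia.
  by move=> m [/S'S].
by move=> m [S'm mj] i; rewrite ltnS leq_eqVlt => /predU1P[->//|]; apply: S'j.
Qed.

Lemma star_ge0 (S : set mono) : (forall m, S m -> mle 0 m) -> forall m, star S m -> mle 0 m.
Proof.
move=> S0; apply: star_ind => //; first exact: mle_refl.
by move=> a b a0 b0; rewrite -[0]addr0; apply: mleD.
Qed.

Lemma star_lfmonoid (K : nat) (S : set mono) : well_ordered S ->
  (forall m, S m -> [/\ mle 0 m, m <> 0 & forall j, (K <= j)%N -> m.2 j = 0]) ->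
  exists P : lfmonoid mono, [/\ forall m, S m -> P m, forall m, P m -> mle 0 m &
    forall m, P m -> forall j, (K <= j)%N -> m.2 j = 0].
Proof.
move=> wS SK; have wP := wo_star wS SK.
have P0 : forall m, star S m -> mle 0 m by apply: star_ge0 => m /SK[].
have Pp a : star S a -> star S (- a) -> a = 0.
  move=> /P0 a0 /P0 /mleN; rewrite opprK -[- 0]/(- (0 : mono)) oppr0 => a0'.
  exact: mle_anti.
exists (LFMonoid (star0 S) (@starD S) Pp (fun q => wo_fin q wP wP)); split=> //=.
- exact: star_sub.
- apply: star_ind => //=.
    by move=> a b aK bK j jK; rewrite -[LHS]/(a.2 j + b.2 j) aK // bK.
  by move=> m /SK[].
Qed.

(** * Iterated conjugation *)

Definition null_seq (u : nat -> R) :=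
  forall e : R, 0 < e -> exists N, forall n, (N <= n)%N -> `|u n| < e.

Lemma null_seqP (u : nat -> R) (l : R) : Un_cv u l <-> null_seq (fun n => u n - l).
Proof.
split=> h e e0.
  have /RltP e0' := e0; have [N hN] := h e e0'; exists N => n /ssrnat.leP Nn.
  by apply/RltP; rewrite -RdistE; apply: hN.
have /RltP e0' := e0; have [N hN] := h e e0'; exists N => n /ssrnat.leP Nn.
by have /RltP := hN n Nn; rewrite -RdistE.
Qed.

Lemma null_seq0 : null_seq (fun _ => 0).
Proof. by move=> e e0; exists 0%N => n _; rewrite normr0. Qed.

Lemma null_seqD u v : null_seq u -> null_seq v -> null_seq (fun n => u n + v n).
Proof.
move=> hu hv e e0; have e2 : 0 < e / 2 by lra.
have [N hN] := hu _ e2; have [M hM] := hv _ e2; exists (maxn N M) => n.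
rewrite geq_max => /andP[/hN un /hM vn]; apply: le_lt_trans (ler_normD _ _) _; lra.
Qed.

Lemma null_seqM a u : null_seq u -> null_seq (fun n => a * u n).
Proof.
move=> hu e e0; have a1 : 0 < `|a| + 1 by rewrite ltr_wpDl.
have [N hN] := hu (e / (`|a| + 1)) (divr_gt0 e0 a1); exists N => n /hN un.
rewrite normrM; apply: (@le_lt_trans _ _ ((`|a| + 1) * `|u n|)).
  by apply: ler_wpM2r => //; rewrite lerDl.
by rewrite mulrC -ltr_pdivlMr.
Qed.

Lemma null_seqX q : 0 <= q < 1 -> null_seq (fun n => q ^+ n).
Proof.
move=> /andP[q0 q1] e /RltP e0.
have qq : Rlt (Rabs q) 1 by apply/RltP; rewrite RabsE ger0_norm.
have [N hN] := pow_lt_1_zero q qq e e0; exists N => n /ssrnat.leP Nn.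
by have /RltP := hN n Nn; rewrite RabsE RpowE.
Qed.

Lemma null_seq_rec q (u e : nat -> R) : 0 <= q < 1 -> null_seq e ->
  (forall n, u n.+1 = q * u n + e n) -> null_seq u.
Proof.
move=> q01 he uE d d0; have /andP[q0 q1] := q01.
(* Perturbations below [d (1 - q) / 2], damped by the factor [q] at each step, accumulate to at most
   [d / 2]. *)
have t0 : 0 < d * (1 - q) / 2 by rewrite divr_gt0 // mulr_gt0 // subr_gt0.
have [N hN] := he _ t0.
have bnd k : `|u (N + k)%N| <= `|u N| * q ^+ k + d / 2.
  elim: k => [|k IH]; first by rewrite addn0 expr0 mulr1; lra.
  rewrite addnS uE exprS; apply: le_trans (ler_normD _ _) _; rewrite normrM (ger0_norm q0).
  have h1 := ler_wpM2l q0 IH; have h2 := ltW (hN (N + k)%N (leq_addr _ _)).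
  by apply: le_trans (lerD h1 h2) _; rewrite le_eqVlt; apply/orP; left; apply/eqP; field.
have d2 : 0 < d / 2 by lra.
have [M hM] := null_seqM `|u N| (null_seqX q01) d2.
exists (N + M)%N => n Nn; have -> : n = (N + (n - N))%N by lia.
apply: le_lt_trans (bnd _) _; have := hM (n - N)%N ltac:(lia).
by rewrite ger0_norm ?mulr_ge0 ?exprn_ge0 //; lra.
Qed.

Section Conjugation.
Variables (G : zmodType) (P : lfmonoid G).
Local Notation B := (hser P R).
Local Notation mon := (hmon P R).
Variables (Ta Tb D0 : B -> B) (a b e : G -> B) (I : set G).
Hypotheses (Tac : cont Ta) (Tbc : cont Tb) (D0c : cont D0).
Hypotheses (TaE : forall p, P p -> Ta (mon p) = mon p * a p)
  (TbE : forall p, P p -> Tb (mon p) = mon p * b p)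
  (D0E : forall p, P p -> D0 (mon p) = mon p * e p).
Hypotheses (IP : forall m, I m -> P m) (IDP : forall m p, I m -> P p -> I (m + p)).
Hypothesis eI : forall p, P p -> hideal I (e p).

Definition conj_iter n (u : B) : B := iter n Ta (D0 (iter n Tb u)).

Lemma iter_cont n T : cont T -> cont (iter n T : B -> B).
Proof.
by move=> cT; elim: n => [|n IH]; [exact: cont_id|exact: cont_comp].
Qed.

Lemma conj_iter_cont n : cont (conj_iter n).
Proof.
apply: (cont_comp (iter_cont n Tac)); apply: cont_comp => //; exact: iter_cont.
Qed.

(** The matrix entry in row [q] and column [p]. *)
Definition cmat n q p : R := conj_iter n (mon p) q.

Lemma cmatS n q p : P p -> cmat n.+1 q p =
  \sum_(s <- dv P q) \sum_(r <- dv P s) (b p (r - p) * cmat n s r) * a s (q - s).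
Proof.
move=> Pp; rewrite /cmat /conj_iter iterS iterSr -/(conj_iter n _) (cont_coef _ _ Tac).
apply: eq_big_seq => s /dvP[Ps _]; rewrite (TaE Ps) hcoef_monM //.
rewrite (cont_coef _ _ (conj_iter_cont n)) mulr_suml.
by apply: eq_bigr => r _; rewrite TbE // hcoef_monM.
Qed.

(** The initial operator raises monomials by elements of [I], the outer ones by elements of [P], and
    [I] absorbs [P]. *)
Lemma cmat_supp n q p : P p -> cmat n q p != 0 -> I (q - p).
Proof.
elim: n q p => [|n IH] q p Pp.
  by rewrite /cmat /conj_iter /= D0E // hcoef_monM // => /eI; apply.
move=> nz; apply: contrapT => nI; case/eqP: nz.
rewrite cmatS // big1_seq // => s /andP[_ sq]; rewrite big1_seq // => r /andP[_ rs].
apply/eqP; apply/negPn/negP; rewrite !mulf_eq0 !negb_or -andbA => /and3P[/hser_in Prp sr /hser_in Pqs].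
have Isr : I (s - r) by apply: IH sr; case/dvP: rs.
apply: nI; have -> : q - p = (s - r) + ((r - p) + (q - s)).
  by rewrite addrA [s - r + _]addrA subrK [RHS]addrC addrA subrK.
by apply: IDP => //; apply: lfmD.
Qed.

(* Z abstracts the two uses: Z u := forall n, u n = 0, and convergence to 0. *)
Lemma cmat_rec (Z : (nat -> R) -> Prop) q p :
  Z (fun _ => 0) -> (forall u v, Z u -> Z v -> Z (fun n => u n + v n)) ->
  (forall c u, Z u -> Z (fun n => c * u n)) ->
  P p -> I (q - p) ->
  (forall s r, P r -> I (s - r) -> s - r \in dv P (q - p) -> s - r != q - p ->
     Z (fun n => cmat n s r)) ->
  exists2 E, Z E & forall n, cmat n.+1 q p = (b p 0 * a q 0) * cmat n q p + E n.
Proof.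
move=> Z0 ZD ZM Pp Iqp Zsr.
have Zsum (J : eqType) (s : seq J) (Q : pred J) (F : J -> nat -> R) :
    (forall j, j \in s -> Q j -> Z (F j)) -> Z (fun n => \sum_(j <- s | Q j) F j n).
  elim: s => [|j s IH] h.
    by rewrite (_ : (fun _ => _) = fun _ => 0) //; apply/funext => n; rewrite big_nil.
  have hs : Z (fun n => \sum_(j <- s | Q j) F j n).
    by apply: IH => i si; apply: h; rewrite inE si orbT.
  have [Qj|nQj] := boolP (Q j).
    rewrite (_ : (fun _ => _) = fun n => F j n + \sum_(j <- s | Q j) F j n).
      by apply: ZD => //; apply: h; rewrite ?mem_head.
    by apply/funext => n; rewrite big_cons Qj.
  by rewrite (_ : (fun _ => _) = fun n => \sum_(j <- s | Q j) F j n) //;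
    apply/funext => n; rewrite big_cons (negPf nQj).
pose t s r n := (b p (r - p) * cmat n s r) * a s (q - s).
have Zt s r : r \in dv P s -> ~ (s = q /\ r = p) -> Z (t s r).
  move=> rs sr_ne; have Pr : P r by case/dvP: rs.
  have tE : t s r = fun n => (b p (r - p) * a s (q - s)) * cmat n s r.
    by apply/funext => n; rewrite /t mulrAC.
  have [b0|/hser_in Prp] := eqVneq (b p (r - p)) 0.
    by rewrite tE b0 mul0r (_ : (fun _ => _) = fun _ => 0) //; apply/funext => n; rewrite mul0r.
  have [a0|/hser_in Pqs] := eqVneq (a s (q - s)) 0.
    by rewrite tE a0 mulr0 (_ : (fun _ => _) = fun _ => 0) //; apply/funext => n; rewrite mul0r.
  rewrite tE; apply: ZM; have [Isr|nI] := pselect (I (s - r)); last first.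
    rewrite (_ : (fun _ => _) = fun _ => 0) //; apply/funext => n.
    by apply/eqP/negPn/negP => /(cmat_supp Pr).
  (* The cofactor of [s - r] in [q - p] lies in [P], and by pointedness it is trivial only for
     [s = q] and [r = p]. *)
  have dE : q - p - (s - r) = (q - s) + (r - p).
    by rewrite opprB addrA [q - p + r]addrAC [q + r - p - s]addrAC [q + r - s]addrAC addrA.
  apply: Zsr => //; first by apply/dvP; split; [exact: IP|rewrite dE; apply: lfmD].
  apply/eqP => e0; have z : (q - s) + (r - p) = 0 by rewrite -dE e0 subrr.
  have qs0 : q - s = 0.
    by apply: (lfm_pointed Pqs); move/eqP: z; rewrite addrC addr_eq0 => /eqP <-.
  move: z; rewrite qs0 add0r => /eqP; rewrite subr_eq0 => /eqP rp.
  by move/eqP: qs0; rewrite subr_eq0 => /eqP qs; apply: sr_ne.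
have pq : p \in dv P q by apply/dvP; split=> //; apply: IP.
have qq : q \in dv P q by apply: dv_refl; apply: dv_gt0 pq.
exists (fun n => \sum_(r <- dv P q | r != p) t q r n +
                 \sum_(s <- dv P q | s != q) \sum_(r <- dv P s) t s r n).
  apply: ZD.
    by apply: (@Zsum) => r rq rp; apply: Zt => // -[_ e0]; rewrite e0 eqxx in rp.
  apply: (@Zsum) => s sq sq'; apply: (@Zsum) => r rs _; apply: Zt => // -[e0 _].
  by rewrite e0 eqxx in sq'.
move=> n; rewrite cmatS // (bigD1_seq q) ?dv_uniq //= (bigD1_seq p) ?dv_uniq //=.
by rewrite /t !subrr -addrA; congr (_ + _); rewrite mulrAC.
Qed.

(** No proper divisor of [d] lies in [I], so the lower entries in the recursion vanish and only the
    diagonal factor remains. *)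
Lemma cmat_const d n : I d -> (forall m, I m -> m \in dv P d -> m = d) ->
  cmat n d 0 = (b 0 0 * a d 0) ^+ n * e 0 d.
Proof.
move=> Id dmin; have P0 := lfm0 P.
have [E E0 rec] : exists2 E : nat -> R, (forall n, E n = 0) &
    forall n, cmat n.+1 d 0 = (b 0 0 * a d 0) * cmat n d 0 + E n.
  apply: (cmat_rec (Z := fun u => forall n, u n = 0)) => //.
  - by move=> u v u0 v0 k; rewrite u0 v0 addr0.
  - by move=> c u u0 k; rewrite u0 mulr0.
  - by rewrite subr0.
  - by rewrite subr0 => s r Pr Isr srd /eqP []; apply: dmin.
elim: n => [|n IH]; last by rewrite rec E0 addr0 IH exprS mulrA.
by rewrite /cmat /conj_iter /= D0E // hcoef_monM // subr0 mul1r.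
Qed.

Lemma cmat_null q p : (forall q p, P p -> I (q - p) -> 0 <= b p 0 * a q 0 < 1) ->
  P p -> null_seq (fun n => cmat n q p).
Proof.
move=> lt1; have [N] := ubnP (size (dv P (q - p))); elim: N q p => // N IH q p szN Pp.
have [Iqp|nI] := pselect (I (q - p)); last first.
  rewrite (_ : (fun _ => _) = fun _ => 0); first exact: null_seq0.
  by apply/funext => n; apply/eqP/negPn/negP => /(cmat_supp Pp).
have [E hE rec] : exists2 E, null_seq E &
    forall n, cmat n.+1 q p = (b p 0 * a q 0) * cmat n q p + E n.
  apply: cmat_rec => //.
  - exact: null_seq0.
  - exact: null_seqD.
  - exact: null_seqM.
  move=> s r Pr Isr srd srne; apply: IH => //.
  by apply: leq_trans (ltn_size_dv srd srne) _; rewrite -ltnS.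
exact: null_seq_rec (lt1 _ _ Pp Iqp) hE rec.
Qed.

End Conjugation.

(** * Composition operators attached to transseries *)

Section CompositionOperator.
Variables (P : lfmonoid mono) (K : nat).
Hypothesis ellP : forall j, (j < K)%N -> P (ellm j).
Hypothesis levP : forall m, P m -> forall j, (K <= j)%N -> m.2 j = 0.
Local Notation B := (hser P R).
Implicit Types (g : series) (T : B -> B) (x u : B).

Definition comp_op g T := exists c x,
  [/\ 0 < c, x 0 = 0, g = emb zmono (c *: (1 + x)) & T =1 tsub K c x].

Lemma comp_op_cont g T : comp_op g T -> cont T.
Proof. by case=> c [x [_ _ _ TE]]; rewrite (funext TE); apply: tsub_cont. Qed.

Lemma tcomp_op g T u : comp_op g T -> tcomp (emb zmono u) g = emb zmono (T u).
Proof. by case=> c [x [c0 x0 gE ->]]; apply: (tcomp_rep ellP levP c0 x0 gE). Qed.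

Lemma comp_op1 g T : comp_op g T -> g = emb zmono (T 1).
Proof.
case=> c [x [c0 x0 gE ->]].
by rewrite (tsubE ellP) // (csub1 ellP) // (uval_z ellP) // mulr1.
Qed.

Lemma comp_op_uniq g T T' : comp_op g T -> comp_op g T' -> T =1 T'.
Proof.
case=> c [x [c0 x0 gE TE]] [c' [x' [c0' x0' gE' TE']]] u; rewrite TE TE'.
have e : c *: (1 + x) = c' *: (1 + x') by apply: (@emb_inj P zmono); rewrite -gE -gE'.
have cc : c = c' by rewrite -(rep_lead c x0) e rep_lead.
suff -> : x = x' by rewrite cc.
have := congr1 (fun w => c^-1 *: w) e; rewrite -cc !scalerA mulVf ?gt_eqF // !scale1r.
exact: addrI.
Qed.

Lemma comp_op_comp g h Tg Th : comp_op g Tg -> comp_op h Th ->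
  comp_op (tcomp g h) (fun u => Th (Tg u)).
Proof.
case=> [c [x [c0 x0 gE TgE]]] opH; have [d [y [d0 y0 hE ThE]]] := opH.
exists (c * d), (bmul y (csub K d y x)); split.
- exact: mulr_gt0.
- exact: xgh0.
- by rewrite gE (tcomp_op _ opH) ThE (tsub_affine ellP).
- by move=> u; rewrite TgE ThE (tsub_comp ellP).
Qed.

Lemma psapp_0 (a : nat -> R) : psapp a (0 : B) = a 0%N *: 1.
Proof.
apply: hserP => q; rewrite hcoefZ hcoef1.
rewrite (psappE _ (N := (size (dv P q)).+1)) ?hcoef0 // big_ord_recl /= expr0 hcoef1.
by rewrite big1 ?addr0 // => i _; rewrite expr0n hcoef0 mulr0.
Qed.

Lemma uval_id m : uval K 1 (0 : B) m = 1.
Proof.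
have b1 a : bin a (0 : B) = 1.
  by rewrite [LHS]psapp_0 gpoly_horner big_ord0 fact0 divr1 scale1r.
have l0 : hlog (0 : B) = 0 by rewrite [LHS]psapp_0 /gpoly big_ord0 coefZ coef1 mulr0 scale0r.
have g0 : geom (0 : B) = 0 by rewrite [LHS]psapp_0 scale0r.
have d0 j : dl 1 (0 : B) j = 0.
  elim: j => [|j IH] /=; rewrite ?IH l0 ?mulr0 ?g0 // ln_1.
  by rewrite -[IZR 0]/(0 : R) scale0r addr0 mulr0 g0.
rewrite /uval b1 mul1r big1; last by move=> j _; rewrite d0 b1.
by rewrite /Rpower ln_1 Rmult_0_r exp_0 scale1r.
Qed.

Lemma comp_op_id : comp_op idz id.
Proof.
exists 1, 0; split; [exact: ltr01|exact: hcoef0| |].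
  by rewrite addr0 scale1r; apply: mon_emb.
apply: (cont_ext (cont_id _ _) (tsub_cont _ _ _)) => p Pp.
by rewrite tsub_mon // uval_id mulr1.
Qed.

Lemma comp_op_iter g T n : comp_op g T -> comp_op (iterc n g) (iter n T).
Proof.
move=> opg; elim: n => [|n IH]; first exact: comp_op_id.
rewrite (_ : iter n.+1 T = fun u => iter n T (T u)); first exact: comp_op_comp.
by apply/funext => u; rewrite iterSr.
Qed.

End CompositionOperator.

(** * The common monoid, and leading terms of inverses and normal forms *)

Definition admissible (K : nat) (g : series) :=
  [/\ well_ordered (Defs.support g), forall m, g m != 0 -> forall j, (K <= j)%N -> m.2 j = 0
    & forall m, g m != 0 -> mle zmono m].

Lemma wo_shift (S : set mono) v : well_ordered S -> well_ordered [set m | S (m + v)].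
Proof.
move=> wS A AS [a Aa]; have [||m Am minm] := wS [set m | A (m - v)].
- by move=> m /AS /=; rewrite subrK.
- by exists (a + v); rewrite /= addrK.
exists (m - v) => // m' Am'; have := minm (m' + v).
by rewrite /= addrK => /(_ Am') /(mle_add2r (- v)); rewrite addrK.
Qed.

Lemma wo_ells (K : nat) : well_ordered [set m | exists2 j, (j < K)%N & m = ellm j].
Proof.
elim: K => [|K IH]; first by move=> A A0 [a /A0[]].
apply: (wo_sub _ (woU IH (@wo1 (ellm K)))) => m [j]; rewrite ltnS leq_eqVlt.
by move=> /predU1P[->|jK] ->; [right|left; exists j].
Qed.

Lemma ellm_ge0 j : mle 0 (ellm j).
Proof.
right; split=> //; right; exists j => /=; rewrite eqxx; split=> // i ij.
by rewrite ltn_eqF.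
Qed.

Lemma common_monoid (K : nat) (gs : seq series) :
  (forall g, g \in gs -> admissible K g) ->
  exists P : lfmonoid mono, [/\ forall j, (j < K)%N -> P (ellm j),
    forall m, P m -> forall j, (K <= j)%N -> m.2 j = 0,
    forall m, P m -> mle 0 m &
    forall g m, g \in gs -> g m != 0 -> P (m - zmono)].
Proof.
move=> adm.
(* The monomial 1 is left out, because Neumann's lemma asks for generators strictly above it. *)
pose S := [set m | m <> 0 /\ exists2 g, g \in gs & g (m + zmono) != 0] `|`
          [set m | exists2 j, (j < K)%N & m = ellm j].
have [|m|P [SP P0 PK]] := @star_lfmonoid K S.
- apply: (woU _ (@wo_ells K)).
  elim: gs adm {S} => [|g gs IH] adm; first by move=> A A0 [a /A0[_ []]].
  have [wg _ _] := adm g (mem_head _ _).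
  have wgs := IH (fun g' g's => adm g' (mem_behead (s := g :: gs) g's)).
  apply: (wo_sub _ (woU (@wo_shift _ zmono wg) wgs)) => m [m0 [g']].
  by rewrite inE => /predU1P[->|g's] gm; [left|right; split=> //; exists g'].
- case=> [[m0 [g /adm[_ gK gz] gm]]|[j jK ->]]; split=> //.
  + by have /mle_subr := gz _ gm; rewrite addrK.
  + move=> j jK; have := gK _ gm j jK.
    by rewrite -[LHS]/(m.2 j + 0) addr0.
  + exact: ellm_ge0.
  + by apply/eqP/ellm_neq0.
  + by move=> i Ki /=; rewrite gtn_eqF //; apply: leq_trans Ki.
exists P; split=> //; first by move=> j jK; apply: SP; right; exists j.
move=> g m gs_g gm; have [->|mz] := pselect (m = zmono); first by rewrite subrr; apply: lfm0.
apply: SP; left; split; last by exists g => //; rewrite subrK.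
by move=> e; apply: mz; rewrite -(subrK zmono m) e add0r.
Qed.

(** Composition with [g] only raises monomials and multiplies the leading one by a power of [c]. The
    least monomial of [F] therefore survives in [F o g = z], and must be [z]. *)
Lemma left_inverse_lead (K : nat) (c : R) (g F : series) : 0 < c -> admissible K g ->
  lead_term_z c g -> well_ordered (Defs.support F) ->
  (forall m, F m != 0 -> forall j, (K <= j)%N -> m.2 j = 0) ->
  tcomp F g = idz -> lead_term_z c^-1 F.
Proof.
move=> c0 ag lg wF FK Fg.
have [|P [ellP levP P0 gP]] := @common_monoid K [:: g].
  by move=> g'; rewrite inE => /eqP ->.
have [|x [x0 gE]] := @rep_exists P g c _ lg (fun m => gP g m (mem_head _ _)).
  by rewrite gt_eqF.
have idz1 m : idz m = (m == zmono)%:R.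
  by rewrite /idz /mon; case: pselect => [mz|mz] /=; [rewrite mz eqxx|move/eqP/negPf: mz => ->].
have [FF|F0] := pselect (Defs.support F !=set0); last first.
  have : tcomp F g zmono = 1 by rewrite Fg idz1 eqxx.
  rewrite /tcomp fsbig1 => [/eqP|m _]; first by rewrite eq_sym oner_eq0.
  have -> : F m = 0 by apply: contrapT => /eqP Fm; apply: F0; exists m.
  exact: mul0r.
have [m0 Fm0 minF] := wF _ (fun _ h => h) FF.
have val : F m0 * Rpower c m0.1 = (m0 == zmono)%:R.
  rewrite -idz1 -Fg /tcomp (fsum_uniq_supp (s := [:: m0])) //.
    rewrite big_seq1 (mono_comp_rep ellP c0 x0 gE) /emb ?subrr ?(uval_coef0 ellP) //.
    exact: FK.
  move=> m; rewrite inE mulf_eq0 negb_or => /andP[Fm].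
  rewrite (mono_comp_rep ellP c0 x0 gE); last exact: FK.
  move=> /hser_in/P0 h; apply/eqP; apply: mle_anti; last exact: minF.
  by have := mle_add2r m h; rewrite add0r subrK.
have Rp0 : Rpower c m0.1 != 0.
  by rewrite gt_eqF //; apply/RltP; apply: exp_pos.
have m0z : m0 = zmono.
  apply/eqP; apply: contraT => /negPf mz; move/eqP: val.
  by rewrite mz mulf_eq0 (negPf Fm0) (negPf Rp0).
move: val; rewrite m0z eqxx /= Rpower_1; last exact/RltP.
move=> Fz; split; last by rewrite -/zmono -m0z.
by rewrite -/zmono -[LHS](mulfK (_ : c != 0)) ?gt_eqF // Fz div1r.
Qed.

(** The least exponent of [z] is 1 and no smaller one occurs, so the bound [m.1 <= 1] cuts out
    exactly the block. *)
Lemma leading_block_parabolic (f : series) m : parabolic f ->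
  leading_block f m = if m.1 <= 1 then f m else 0.
Proof.
move=> [f1 fz]; rewrite /leading_block; case: pselect => /= h.
  by rewrite (h zmono) // [f zmono]f1 oner_eq0.
case: ifP => // m1; case: h => m' /fz [/ltW|[<- _]] /=; [exact: le_trans|exact: m1].
Qed.

Lemma InL_level (k K : nat) (f : series) : (k <= K)%N -> InL k f ->
  well_ordered (Defs.support f) /\ forall m, f m != 0 -> forall j, (K <= j)%N -> m.2 j = 0.
Proof.
move=> kK [fk wf]; split=> // m /fk[_ mk] j Kj; apply: mk; exact: leq_trans Kj.
Qed.

Lemma InL_admissible (k K : nat) (c : R) (f : series) : (k <= K)%N -> InL k f ->
  lead_term_z c f -> admissible K f.
Proof. by move=> kK /(InL_level kK)[wf fK] [_ fz]; split. Qed.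

Lemma normal_form_supp k (f : series) m : normal_form k f m != 0 -> f m != 0.
Proof. by rewrite /normal_form; case: pselect => //=; rewrite eqxx. Qed.

Lemma normal_form_admissible (k K : nat) (f : series) : admissible K f ->
  admissible K (normal_form k f).
Proof.
move=> [wf fK fz]; split=> [|m /normal_form_supp|m /normal_form_supp]; [|exact: fK|exact: fz].
by apply: wo_sub wf => m; apply: normal_form_supp.
Qed.

Lemma normal_form_lead k (c : R) (f : series) : lead_term_z c f -> lead_term_z c (normal_form k f).
Proof.
move=> [fc fz]; split=> [|m /normal_form_supp /fz //].
rewrite /normal_form; case: pselect => //= -[]; split=> //; split=> //; split; first by left.
case: k => [|k]; first by left.
by right; exists 0%N.
Qed.

Lemma Rpower_conj (lam s t : R) : 0 < lam ->
  Rpower lam^-1 s * Rpower lam t = Rpower lam (t - s).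
Proof.
move=> /RltP l0; rewrite /Rpower -[lam^-1]/(Rinv lam) ln_Rinv // -[_ * _]exp_plus.
by congr exp; rewrite !(RplusE, RminusE, RmultE, RoppE); ring.
Qed.

Lemma Rpower_lt1 (lam t : R) : 0 < lam < 1 -> 0 < t -> Rpower lam t < 1.
Proof.
move=> /andP[/RltP l0 /RltP l1] t0; apply/RltP; rewrite /Rpower -[X in Rlt _ X]exp_0.
apply: exp_increasing; apply/RltP; rewrite RmultE.
have /RltP : Rlt (ln lam) 0 by rewrite -[X in Rlt _ X]ln_1; apply: ln_increasing.
by move=> l; rewrite pmulr_rlt0.
Qed.

(** * The differences between the Koenigs sequence and its candidate limit *)

Section Koenigs.
Variables (P : lfmonoid mono) (K : nat) (lam : R).
Hypothesis ellP : forall j, (j < K)%N -> P (ellm j).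
Hypothesis levP : forall m, P m -> forall j, (K <= j)%N -> m.2 j = 0.
Hypothesis P0 : forall m, P m -> mle 0 m.
Hypothesis lam01 : 0 < lam < 1.
Local Notation B := (hser P R).
Variables (xf xi xh xp : B).
Hypotheses (xf0 : xf 0 = 0) (xi0 : xi 0 = 0) (xh0 : xh 0 = 0) (xp0 : xp 0 = 0).
Local Notation Tf := (tsub K lam xf).
Local Notation Ti := (tsub K lam^-1 xi).
Local Notation Th := (tsub K 1 xh).
Local Notation Tp := (tsub K 1 xp).
Local Notation diff := (conj_iter Tf Ti (fun u => Th u - Tp u)).

Variable d : mono.
Hypotheses (xd : (xh - xp) d != 0) (dmin : forall m, (xh - xp) m != 0 -> mle d m).

Let a p := uval K lam xf (zmono + p).
Let b p := uval K lam^-1 xi (zmono + p).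
Let e p := uval K 1 xh (zmono + p) - uval K 1 xp (zmono + p).
Let I : set mono := [set m | P m /\ mle d m].

Let eE p : P p -> Th (hmon P R p) - Tp (hmon P R p) = hmon P R p * e p.
Proof. by move=> Pp; rewrite !tsub_mon // -mulrBr. Qed.

Let IP m : I m -> P m. Proof. by case. Qed.

Let IDP m p : I m -> P p -> I (m + p).
Proof.
move=> [Pm dm] Pp; split; first exact: lfmD.
by rewrite -[d]addr0; apply: mleD => //; apply: P0.
Qed.

Let eI p : P p -> hideal I (e p).
Proof.
move=> Pp; apply: uval_ideal => // m mne; split; [exact: hser_in mne|exact: dmin].
Qed.

Let Dc : cont (fun u => Th u - Tp u).
Proof. by apply: cont_sub; apply: tsub_cont. Qed.

(** The shift by [z] cancels between the factors of [f] and of the inverse of [f_0], whose leading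
    coefficients are inverse to each other. *)
Let ba q p : b p 0 * a q 0 = Rpower lam (q - p).1.
Proof.
have /andP[l0 _] := lam01.
have -> : a q 0 = Rpower lam (zmono + q).1 := uval_coef0 ellP lam (zmono + q) xf0.
have -> : b p 0 = Rpower lam^-1 (zmono + p).1 := uval_coef0 ellP lam^-1 (zmono + p) xi0.
rewrite Rpower_conj //; congr Rpower.
by rewrite -[LHS]/((1 + q.1) - (1 + p.1)) -[RHS]/(q.1 - p.1); ring.
Qed.

Lemma diff_const n : diff n 1 d = Rpower lam d.1 ^+ n * (xh - xp) d.
Proof.
have := @cmat_const _ _ Tf Ti _ a b e I (tsub_cont _ _ _) (tsub_cont _ _ _) Dc
  (@tsub_mon _ _ _ _) (@tsub_mon _ _ _ _) eE IP IDP eI d n.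
rewrite /cmat hmon0 => ->; last 2 first.
- by split; [exact: hser_in xd|exact: mle_refl].
(* A divisor of [d] is at most [d] in the order, while elements of [I] are at least [d]. *)
- move=> m [Pm dm] /dvP[_ /P0 h]; apply: mle_anti => //.
  by have := mle_add2r m h; rewrite add0r subrK.
rewrite ba subr0 /e addr0 !(uval_z ellP) // !scale1r; congr (_ * _).
by rewrite opprD addrACA subrr add0r.
Qed.

Lemma diff_null q : 0 < d.1 -> null_seq (fun n => diff n 1 q).
Proof.
move=> d0.
have := @cmat_null _ _ Tf Ti _ a b e I (tsub_cont _ _ _) (tsub_cont _ _ _) Dc
  (@tsub_mon _ _ _ _) (@tsub_mon _ _ _ _) eE IP IDP eI q 0.
rewrite /cmat hmon0; apply; last exact: lfm0.
move=> {}q p Pp [_ dq]; rewrite ba; apply/andP; split.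
  by apply/ltW/RltP; apply: exp_pos.
apply: Rpower_lt1 => //; apply: (lt_le_trans d0).
by case: dq => [/ltW|[->]].
Qed.

End Koenigs.

(** From [T A' = A T] and [A' C = 1] one gets [A T C = T], so [T] is fixed under conjugation. It is
    applied to the operator of [phi]. *)
Lemma iter_conjugate (X : Type) (A C T T' A' : X -> X) :
  (forall u, A' (C u) = u) -> (forall u, T (T' u) = u) ->
  (forall u, A' u = T' (A (T u))) -> forall n u, iter n A (T (iter n C u)) = T u.
Proof.
move=> AC TT A'E; elim=> // n IH u.
by rewrite iterS [iter _ C _]iterSr IH -[LHS]TT -A'E AC.
Qed.

Theorem mainTheorem3 (k : nat) (lam : R) (f f0inv phi phiinv : series)
  (m : nat) (h : series) :
  InL k f -> 0 < lam < 1 -> lead_term_z lam f ->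
  (* f0inv is the compositional inverse of the normal form f_0 *)
  InL k f0inv ->
  tcomp (normal_form k f) f0inv = idz -> tcomp f0inv (normal_form k f) = idz ->
  (* phi in L_k^0 with phi o f o phi^{-1} = f_0 *)
  InL k phi -> parabolic phi ->
  InL k phiinv -> tcomp phi phiinv = idz -> tcomp phiinv phi = idz ->
  tcomp (tcomp phi f) phiinv = normal_form k f ->
  (* h in L_m^0 *)
  InL m h -> parabolic h ->
  (weak_cvg (maxn k m)
     (fun n => tcomp (iterc n f0inv) (tcomp h (iterc n f))) phi
   <-> leading_block h = leading_block phi).
Proof.
move=> Lf lam01 lf Li _ iK Lp lp Lq _ qK conj Lh lh.
have /andP[l0 l1] := lam01; pose K := maxn k m; pose f0 := normal_form k f.
have kK : (k <= K)%N := leq_maxl _ _; have mK : (m <= K)%N := leq_maxr _ _.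
have af := InL_admissible kK Lf lf; have ap := InL_admissible kK Lp lp.
have ah := InL_admissible mK Lh lh.
have a0 : admissible K f0 := normal_form_admissible k af.
have l0' : lead_term_z lam f0 := normal_form_lead k lf.
have [wi iL] := InL_level kK Li; have [wq qL] := InL_level kK Lq.
(* Membership in [L_k] says nothing about the leading terms of the two inverses; these are recovered
   from the left inverse equations. *)
have li : lead_term_z lam^-1 f0inv := left_inverse_lead l0 a0 l0' wi iL iK.
have lq : lead_term_z 1^-1 phiinv := left_inverse_lead ltr01 ap lp wq qL qK.
have ai := InL_admissible kK Li li; have aq := InL_admissible kK Lq lq.
have [|P [ellP levP P0 gP]] := @common_monoid K [:: f; f0; f0inv; phi; phiinv; h].
  by move=> g; rewrite !inE => /or4P[/eqP->|/eqP->|/eqP->|/or3P[]/eqP->].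
have rep g c : g \in [:: f; f0; f0inv; phi; phiinv; h] -> 0 < c -> lead_term_z c g ->
    exists x : hser P R, [/\ x 0 = 0, g = emb zmono (c *: (1 + x)) &
      comp_op K g (tsub K c x)].
  move=> gs c0 lg; have [|x [x0 gE]] := rep_exists _ lg (fun m' => gP g m' gs).
    by rewrite gt_eqF.
  by exists x; split=> //; exists c, x; split.
have [|xf [xf0 _ opf]] := rep f lam _ l0 lf; first by rewrite !inE eqxx.
have [|x0 [_ _ op0]] := rep f0 lam _ l0 l0'; first by rewrite !inE eqxx ?orbT.
have i0 : 0 < lam^-1 by rewrite invr_gt0.
have [|xi [xi0 _ opi]] := rep f0inv _ _ i0 li; first by rewrite !inE eqxx ?orbT.
have [|xp [xp0 pE opp]] := rep phi _ _ ltr01 lp; first by rewrite !inE eqxx ?orbT.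
have q0 : 0 < 1^-1 :> R by rewrite invr_gt0.
have [|xq [_ _ opq]] := rep phiinv _ _ q0 lq; first by rewrite !inE eqxx ?orbT.
have [|xh [xh0 hE oph]] := rep h _ _ ltr01 lh; first by rewrite !inE eqxx ?orbT.
set Tf := tsub _ _ _ in opf; set T0 := tsub _ _ _ in op0; set Ti := tsub _ _ _ in opi.
set Tp := tsub _ _ _ in opp; set Tq := tsub _ _ _ in opq; set Th := tsub _ _ _ in oph.
(* Operators compose in the opposite order to series, so [f0inv o f0 = z] yields [T0 (Ti u) = u]. *)
have TiK u : T0 (Ti u) = u.
  have := comp_op_comp ellP levP opi op0; rewrite iK => hh.
  exact: (comp_op_uniq hh (comp_op_id _ _)).
have TqK u : Tp (Tq u) = u.
  have := comp_op_comp ellP levP opq opp; rewrite qK => hh.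
  exact: (comp_op_uniq hh (comp_op_id _ _)).
have T0E u : T0 u = Tq (Tf (Tp u)).
  have := comp_op_comp ellP levP (comp_op_comp ellP levP opp opf) opq; rewrite conj => hh.
  exact: (comp_op_uniq op0 hh).
have TpE n u : iter n Tf (Tp (iter n Ti u)) = Tp u := iter_conjugate TiK TqK T0E n u.
pose D n := conj_iter Tf Ti (fun u => Th u - Tp u) n.
(* Here [phi] is rewritten as the image of [z] under [Tf^n Tp Ti^n], so that both terms carry the
   same outer iterates and linearity applies. *)
have uE n q : tcomp (iterc n f0inv) (tcomp h (iterc n f)) q - phi q = D n 1 (q - zmono).
  have opn := comp_op_comp ellP levP oph (comp_op_iter ellP levP n opf).
  rewrite (comp_op1 ellP (comp_op_iter ellP levP n opi)) (tcomp_op ellP levP _ opn).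
  rewrite {1}(comp_op1 ellP opp) -(TpE n 1) /emb -hcoefB; congr (hcoef _ _).
  have cn := iter_cont n (comp_op_cont opf).
  rewrite /D /conj_iter addrC -scaleN1r -cn.1; congr (iter _ _ _).
  by rewrite scaleN1r addrC.
have diffE q : (xh - xp) q = h (q + zmono) - phi (q + zmono).
  by rewrite hE pE /emb addrK !scale1r -!hcoefB opprD addrACA subrr add0r.
have LbE : leading_block h = leading_block phi <-> forall q, q.1 <= 1 -> h q = phi q.
  split=> [Lb q q1|hq].
    have := congr1 (fun s : series => s q) Lb.
    by rewrite !leading_block_parabolic // q1.
  by apply/funext => q; rewrite !leading_block_parabolic //; case: ifP => // /hq.
(* If [h = phi] there is no leading monomial of the difference, and the conjugated operator is
   zero. *)
have [hp|hp] := pselect (h = phi).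
  split=> [_|_]; first by rewrite hp.
  move=> c n _ _; apply/null_seqP; rewrite (_ : (fun _ => _) = fun _ => 0); first exact: null_seq0.
  apply/funext => N; rewrite uE /D /conj_iter.
  have xe : xh = xp by apply: hserP => q; apply/eqP; rewrite -subr_eq0 -hcoefB diffE hp subrr.
  have ThE : Th = Tp := congr1 (tsub K 1) xe.
  by rewrite ThE subrr (cont0 (iter_cont N (comp_op_cont opf))) hcoef0.
have [md mdne mdmin] : exists2 md, h md - phi md != 0 &
    forall q, h q - phi q != 0 -> mle md q.
  have [wh _ _] := ah; have [wp _ _] := ap.
  apply: (woU wh wp) => [q|].
    rewrite /Defs.support /=; have [->|] := eqVneq (h q) 0; last by left.
    by rewrite sub0r oppr_eq0; right.
  apply: contrapT => none; apply: hp; apply/funext => q; apply/eqP.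
  by rewrite -subr_eq0; apply/negPn/negP => hq; apply: none; exists q.
pose d := md - zmono.
have xd : (xh - xp) d != 0 by rewrite diffE /d subrK.
have dmin q : (xh - xp) q != 0 -> mle d q.
  by rewrite diffE => /mdmin /(mle_add2r (- zmono)); rewrite addrK.
have d1 : md.1 = 1 + d.1 by rewrite -[d.1]/(md.1 - 1) addrC subrK.
have d0 : 0 <= d.1 by case: (P0 _ (hser_in xd)) => [/ltW|[<-]].
(* If [d] has [z]-exponent 0, both sides of the equivalence fail: the coefficient of the error at
   [md] is a nonzero constant, and the leading blocks differ there. If the exponent is positive,
   both sides hold. *)
move: d0; rewrite le_eqVlt => /predU1P[d0|d0]; split.
- move=> cv; have mdK j : (K <= j)%N -> md.2 j = 0.
    move=> Kj; have := levP _ (hser_in xd) j Kj.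
    by rewrite -[LHS]/(md.2 j - 0) subr0.
  have md0 : 0 <= md.1 by rewrite d1 -d0 addr0 ler01.
  have /null_seqP := cv md.1 md.2 md0 mdK.
  (* The tolerance is the constant absolute value of the error itself. *)
  rewrite -surjective_pairing => /(_ `|(xh - xp) d|).
  rewrite normr_gt0 => /(_ xd) [N /(_ N (leqnn _))].
  rewrite uE /D (diff_const ellP) // -d0.
  by rewrite Rpower_O ?expr1n ?mul1r ?ltxx //; apply/RltP.
- move=> /LbE /(_ md); rewrite d1 -d0 addr0 lexx => /(_ isT) e.
  by move: mdne; rewrite e subrr eqxx.
- move=> _; apply/LbE => q q1; apply/eqP; rewrite -subr_eq0; apply/negPn/negP => /mdmin mq.
  have : md.1 <= q.1 by case: mq => [/ltW|[->]].
  by rewrite d1 => h1; have := le_trans h1 q1; rewrite gerDl leNgt d0.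
- move=> _ c n _ _; apply/null_seqP; rewrite (_ : (fun _ => _) = fun N => D N 1 ((c, n) - zmono)).
    exact: (diff_null ellP P0 lam01 xf0 xi0 dmin).
  by apply/funext => N; rewrite uE.
Qed.
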